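(* Let $0<C<\infty$. Then there exists an analytic function $A$ in $\mathbb{D}$ with $\|A\|_{\mathcal{L}^0}<C$ such that the differential equation $f''+Af=0$ admits a zero-free analytic solution $f$ in $\mathbb{D}$ with $f\in\mathcal{B}\setminus\mathcal{N}$.
   Context: $\mathbb{D}=\{z\in\mathbb{C}:|z|<1\}$ is the open unit disc. For $A$ analytic in $\mathbb{D}$, $\|A\|_{\mathcal{L}^0}=\sup_{z\in\mathbb{D}}|A(z)|(1-|z|^2)^2$. The Bloch space $\mathcal{B}$ consists of all functions $f$ analytic in $\mathbb{D}$ with $\sup_{z\in\mathbb{D}}|f'(z)|(1-|z|^2)<\infty$. The Nevanlinna class $\mathcal{N}$ consists of all functions $f$ analytic in $\mathbb{D}$ with $$\lim_{r\to1^-}\frac1{2\pi}\int_0^{2\pi}\log^+|f(re^{i\theta})|\,d\theta<\infty,\qquad \log^+=\max\{\log,0\}.$$ *)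

(* Defs.v *)
From Stdlib Require Import Reals.
From Coquelicot Require Import Coquelicot.
Local Open Scope R_scope.

Definition unit_disc (z : C) : Prop := Cmod z < 1.

(* Complex differentiability: the scalar field is C, so the derivative is
   C-linear.  Functions are total on C; only their values on the disc matter. *)
Definition analytic_in_disc (f : C -> C) : Prop :=
  forall z : C, unit_disc z -> @ex_derive C_AbsRing C_NormedModule f z.

Definition sup_disc (g : C -> R) : Rbar :=
  Lub_Rbar (fun y : R => exists z : C, unit_disc z /\ y = g z).

Definition L0_norm (A : C -> C) : Rbar :=
  sup_disc (fun z => Cmod (A z) * (1 - Cmod z ^ 2) ^ 2).

(* [C_derive] is total; by [C_derive_correct] it is the complex derivative of
   any function analytic in the disc. *)
Definition Bloch (f : C -> C) : Prop :=
  analytic_in_disc f /\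
  Rbar_lt (sup_disc (fun z => Cmod (C_derive f z) * (1 - Cmod z ^ 2))) p_infty.

(* [ln 0 = 0] in Stdlib, so the value at [0] is [0], as it should be. *)
Definition log_plus (x : R) : R := Rmax (ln x) 0.

Definition circle_point (r theta : R) : C := (r * cos theta, r * sin theta).

Definition log_plus_mean (f : C -> C) (r : R) : R :=
  1 / (2 * PI) *
  RInt (fun theta => log_plus (Cmod (f (circle_point r theta)))) 0 (2 * PI).

(* For analytic [f] the means are nondecreasing in [r], so their limit always exists in [0, +oo];
   membership says that it is finite. *)
Definition Nevanlinna (f : C -> C) : Prop :=
  analytic_in_disc f /\
  exists l : R, filterlim (log_plus_mean f) (at_left 1) (locally l).

Definition solves_ode (A f : C -> C) : Prop :=
  forall z : C, unit_disc z ->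
    Cplus (C_derive (C_derive f) z) (Cmult (A z) (f z)) = RtoC 0.

Definition zero_free (f : C -> C) : Prop :=
  forall z : C, unit_disc z -> f z <> RtoC 0.

(* Main.v *)
Require Import Defs.
From Stdlib Require Import Reals Lra Lia Classical ClassicalEpsilon.
From Coquelicot Require Import Coquelicot.
Local Open Scope R_scope.


(** A zero-free solution can be written f = exp(e g), and then
    A = - (e g'' + e^2 g'^2). If both (1 - |z|^2) |g'(z)| (1 + exp (Re g(z))) and
    (1 - |z|^2)^2 |g''(z)| are bounded in the disc, a small e > 0 makes the
    weighted supremum of A as small as required, and f is a Bloch function because
    exp (e x) <= 1 + exp x. Since log|f| = e Re g, it remains to find such a g for
    which the means of (Re g)^+ over circles are unbounded. The difficulty is
    that the first bound forces g to move slowly wherever Re g is large and positive.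

    The function g is the limit of polynomials g_(j+1) = g_j + z^m q with m huge.
    On the unit circle write X = Re g_j. There |q| should be at most of the order
    of exp(- X^+), and a real polynomial in X, times a suitable power of z, is a
    polynomial in z whose modulus there is the same. So q can be chosen with
    q(exp(it)) = exp(idt) T(t), where T = (1 - X^2/N)^N lies
    between exp (-2 X^2) and exp (- X^2) for N >= 2 X^2 ([peval_bump_poly], [bump_bounds]).
    Such an increment is negligible away from the circle, while near the circle
    its first two derivatives are controlled by the size of q on the circle
    itself. Each step therefore either leaves the two quantities above
    almost unchanged or bounds them by an absolute constant ([step],
    [gs_growth_bound]), and both bounds pass to the limit.

    On the circle X becomes X + T cos(nt) with n huge, which is a random
    walk with steps T adapted to the present position. By the Riemann-Lebesgue lemma its
    mean hardly changes, whereas the mean of the convex function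
    Phi(x) = sqrt(1 + x^2) grows by about half the mean of curv(X) T^2
    ([oscillation_gain]). Were the means of Phi(X) bounded, X would stay in a
    fixed interval for a fixed proportion of the circle; T and curv(X) are
    bounded below there, so each step would gain a fixed amount, which is absurd
    ([gs_test_int_unbounded]). Hence the means of |X|, and with them those of X^+,
    are unbounded ([sol_not_Nevanlinna]). *)

(** * Polynomials *)

(** Polynomials are kept as expressions, so that derivatives, bounds and reflection
    in the unit circle are defined and studied by structural recursion, without
    coefficients or degrees. *)
Inductive cpoly : Type :=
| Pconst (c : C)
| Pmonom (n : nat)
| Padd (p q : cpoly)
| Pmul (p q : cpoly).

Fixpoint peval (p : cpoly) (z : C) : C :=
  match p with
  | Pconst c => c
  | Pmonom n => Cpow z n
  | Padd p q => Cplus (peval p z) (peval q z)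
  | Pmul p q => Cmult (peval p z) (peval q z)
  end.

Fixpoint pderiv (p : cpoly) : cpoly :=
  match p with
  | Pconst _ => Pconst (RtoC 0)
  | Pmonom O => Pconst (RtoC 0)
  | Pmonom (S n) => Pmul (Pconst (RtoC (INR (S n)))) (Pmonom n)
  | Padd p q => Padd (pderiv p) (pderiv q)
  | Pmul p q => Padd (Pmul (pderiv p) q) (Pmul p (pderiv q))
  end.

(** Bounds the polynomial on the closed unit disc. *)
Fixpoint pbound (p : cpoly) : R :=
  match p with
  | Pconst c => Cmod c
  | Pmonom _ => 1
  | Padd p q => pbound p + pbound q
  | Pmul p q => pbound p * pbound q
  end.

Lemma pbound_pos p : 0 <= pbound p.
Proof.
  induction p; simpl; try lra; try (apply Cmod_ge_0).
  now apply Rmult_le_pos.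
Qed.

Lemma pow_le_one x n : 0 <= x <= 1 -> 0 <= x ^ n <= 1.
Proof.
  intros H; induction n; simpl; [lra|]; nra.
Qed.

Lemma peval_le_pbound p z : Cmod z <= 1 -> Cmod (peval p z) <= pbound p.
Proof.
  intros Hz; induction p; simpl.
  - lra.
  - rewrite Cmod_pow. apply pow_le_one; split; [apply Cmod_ge_0 | lra].
  - eapply Rle_trans; [apply Cmod_triangle | lra].
  - rewrite Cmod_mult.
    apply Rmult_le_compat; auto using Cmod_ge_0.
Qed.

Lemma Cmod_sub_comm (x y : C) : Cmod (x - y) = Cmod (y - x).
Proof. rewrite <- (Cmod_opp (x - y)). f_equal; ring. Qed.

Lemma Cmod_mul_sub_le (a b a' b' : C) A B A' B' :
  Cmod a <= A -> Cmod b' <= B -> Cmod (a - a') <= A' -> Cmod (b - b') <= B' ->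
  Cmod (a * b - a' * b') <= A' * B + A * B'.
Proof.
  intros Ha Hb Ha' Hb'.
  replace (a * b - a' * b')%C with ((a - a') * b' + a * (b - b'))%C by ring.
  eapply Rle_trans; [apply Cmod_triangle|]; rewrite !Cmod_mult.
  apply Rplus_le_compat; apply Rmult_le_compat; auto using Cmod_ge_0.
Qed.

Lemma pbound_pderiv_Pmonom n : pbound (pderiv (Pmonom n)) = INR n.
Proof.
  destruct n; cbn [pderiv pbound]; [apply Cmod_0|].
  rewrite Cmod_R, Rabs_pos_eq by apply pos_INR. ring.
Qed.

Lemma peval_lipschitz p z w : Cmod z <= 1 -> Cmod w <= 1 ->
  Cmod (peval p z - peval p w) <= pbound (pderiv p) * Cmod (z - w).
Proof.
  intros Hz Hw; induction p; cbn [peval].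
  - replace (c - c)%C with (RtoC 0) by ring. simpl; rewrite Cmod_0; lra.
  - rewrite pbound_pderiv_Pmonom.
    induction n as [|n IHn].
    + simpl. replace (1 - 1)%C with (RtoC 0) by ring. rewrite Cmod_0; lra.
    + rewrite !Cpow_S.
      eapply Rle_trans.
      * refine (Cmod_mul_sub_le z (z ^ n) w (w ^ n) 1 1 (Cmod (z - w)) (INR n * Cmod (z - w)) _ _ _ _); try lra.
        apply (peval_le_pbound (Pmonom n)); lra.
      * rewrite S_INR. lra.
  - replace (peval p1 z + peval p2 z - (peval p1 w + peval p2 w))%C
      with ((peval p1 z - peval p1 w) + (peval p2 z - peval p2 w))%C by ring. cbn [pderiv pbound].
    eapply Rle_trans; [apply Cmod_triangle|]. lra.
  - eapply Rle_trans.
    + apply (Cmod_mul_sub_le _ _ _ _ (pbound p1) (pbound p2) _ _ (peval_le_pbound _ _ Hz) (peval_le_pbound _ _ Hw) IHp1 IHp2).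
    + cbn [pderiv pbound]; lra.
Qed.

(** The chain rule along a curve, in real coordinates. It serves twice: on
    segments it yields the mean value inequality, and on the unit circle the
    smoothness needed for the Riemann-Lebesgue lemma. *)
Lemma peval_path_derive p (x y : R -> R) t x' y' :
  is_derive x t x' -> is_derive y t y' ->
  is_derive (fun s => Re (peval p (x s, y s))) t (Re (peval (pderiv p) (x t, y t) * (x', y'))%C) /\
  is_derive (fun s => Im (peval p (x s, y s))) t (Im (peval (pderiv p) (x t, y t) * (x', y'))%C).
Proof.
  intros Hx Hy; induction p.
  - simpl. split; (evar_last; [apply is_derive_const | simpl; unfold zero; simpl; ring]).
  - induction n as [|n [IHr IHi]].
    + simpl. split; (evar_last; [apply is_derive_const | simpl; unfold zero; simpl; ring]).
    + assert (E : peval (pderiv (Pmonom (S n))) (x t, y t) = ((x t, y t) * peval (pderiv (Pmonom n)) (x t, y t) + (x t, y t) ^ n)%C).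
      { destruct n.
        - simpl. apply injective_projections; simpl; ring.
        - unfold pderiv. cbn [peval]. rewrite (S_INR (S n)), RtoC_plus, !Cpow_S. ring. }
      rewrite E; clear E.
      set (D := peval (pderiv (Pmonom n)) (x t, y t)) in *.
      cbn [peval] in *.
      split.
      * apply (is_derive_ext (fun s => x s * Re ((x s, y s) ^ n)%C - y s * Im ((x s, y s) ^ n)%C)).
        { intros s; rewrite Cpow_S; simpl; unfold Re, Im; ring. }
        evar_last.
        { apply @is_derive_minus; apply (is_derive_mult (K := R_AbsRing)); try eassumption; intros; apply Rmult_comm. }
        unfold minus, plus, opp, mult; simpl; unfold Re, Im; simpl; ring.
      * apply (is_derive_ext (fun s => x s * Im ((x s, y s) ^ n)%C + y s * Re ((x s, y s) ^ n)%C)).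
        { intros s; rewrite Cpow_S; simpl; unfold Re, Im; ring. }
        evar_last.
        { apply @is_derive_plus; apply (is_derive_mult (K := R_AbsRing)); try eassumption; intros; apply Rmult_comm. }
        unfold minus, plus, opp, mult; simpl; unfold Re, Im; simpl; ring.
  - destruct IHp1 as [r1 i1], IHp2 as [r2 i2]; split; cbn [peval pderiv].
    + apply (is_derive_ext (fun s => Re (peval p1 (x s, y s)) + Re (peval p2 (x s, y s)))); [intros; now rewrite re_plus|].
      evar_last; [apply @is_derive_plus; eassumption|].
      unfold plus; simpl; unfold Re, Im; simpl; ring.
    + apply (is_derive_ext (fun s => Im (peval p1 (x s, y s)) + Im (peval p2 (x s, y s)))); [intros; now rewrite im_plus|].
      evar_last; [apply @is_derive_plus; eassumption|].
      unfold plus; simpl; unfold Re, Im; simpl; ring.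
  - destruct IHp1 as [r1 i1], IHp2 as [r2 i2]; split; cbn [peval pderiv].
    + apply (is_derive_ext (fun s => Re (peval p1 (x s, y s)) * Re (peval p2 (x s, y s)) - Im (peval p1 (x s, y s)) * Im (peval p2 (x s, y s)))).
      { intros s; now rewrite re_mult. }
      evar_last.
      { apply @is_derive_minus; apply (is_derive_mult (K := R_AbsRing)); try eassumption; intros; apply Rmult_comm. }
      unfold minus, plus, opp, mult; simpl; unfold Re, Im; simpl; ring.
    + apply (is_derive_ext (fun s => Re (peval p1 (x s, y s)) * Im (peval p2 (x s, y s)) + Im (peval p1 (x s, y s)) * Re (peval p2 (x s, y s)))).
      { intros s; now rewrite im_mult. }
      evar_last.
      { apply @is_derive_plus; apply (is_derive_mult (K := R_AbsRing)); try eassumption; intros; apply Rmult_comm. }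
      unfold minus, plus, opp, mult; simpl; unfold Re, Im; simpl; ring.
Qed.

(** The real mean value theorem is applied on the segment to the component of
    the polynomial in the direction of the total increment; a complex function
    itself has no mean value theorem. *)
Lemma peval_mean_value p rho B z w :
  (forall u, Cmod u <= rho -> Cmod (peval (pderiv p) u) <= B) ->
  Cmod z <= rho -> Cmod w <= rho ->
  Cmod (peval p w - peval p z) <= B * Cmod (w - z).
Proof.
  intros HB Hz Hw.
  set (d := (w - z)%C). set (D := (peval p w - peval p z)%C).
  set (seg := fun t : R => (fst z + t * fst d, snd z + t * snd d)).
  assert (Haff : forall a b t : R, is_derive (fun s => a + s * b) t b).
  { intros a b t; auto_derive; [easy | ring]. }
  assert (Hseg : forall t, seg t = (z + t * d)%C).
  { intros t; unfold seg; clearbody d; apply injective_projections; simpl; ring. }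
  set (phi := fun t => fst D * Re (peval p (seg t)) + snd D * Im (peval p (seg t))).
  set (dphi := fun t => fst D * Re (peval (pderiv p) (seg t) * d)%C + snd D * Im (peval (pderiv p) (seg t) * d)%C).
  assert (Hd : forall t, is_derive phi t (dphi t)).
  { intros t.
    destruct (peval_path_derive p (fun t => fst z + t * fst d) (fun t => snd z + t * snd d) t (fst d) (snd d)) as [Hr Hi].
    { apply Haff. }
    { apply Haff. }
    unfold phi, dphi. apply @is_derive_plus.
    - apply is_derive_scal. replace (peval (pderiv p) (seg t) * d)%C with (peval (pderiv p) (seg t) * (fst d, snd d))%C by now rewrite <- surjective_pairing.
      exact Hr.
    - apply is_derive_scal. replace (peval (pderiv p) (seg t) * d)%C with (peval (pderiv p) (seg t) * (fst d, snd d))%C by now rewrite <- surjective_pairing.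
      exact Hi. }
  destruct (MVT_gen phi 0 1 dphi) as [xi [Hxi Hphi]].
  { intros; apply Hd. }
  { intros t _. apply derivable_continuous_pt. exists (dphi t). apply is_derive_Reals, Hd. }
  rewrite Rmin_left, Rmax_right in Hxi by lra.
  assert (Hin : Cmod (seg xi) <= rho).
  { rewrite Hseg. replace (z + xi * d)%C with (RtoC (1 - xi) * z + RtoC xi * w)%C
      by (unfold d; rewrite RtoC_minus; ring).
    eapply Rle_trans; [apply Cmod_triangle|].
    rewrite !Cmod_mult, !Cmod_R, !Rabs_pos_eq by lra. nra. }
  assert (Hdphi : dphi xi <= Cmod D * (B * Cmod d)).
  { replace (dphi xi) with (Re (Cconj D * (peval (pderiv p) (seg xi) * d))%C)
      by (unfold dphi, Cconj, Re, Im; simpl; ring).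
    eapply Rle_trans; [apply Rle_abs|]. eapply Rle_trans; [apply re_le_Cmod|].
    rewrite !Cmod_mult, Cmod_conj.
    apply Rmult_le_compat_l; [apply Cmod_ge_0|].
    apply Rmult_le_compat_r; [apply Cmod_ge_0|]. now apply HB. }
  assert (Hsq : phi 1 - phi 0 = Cmod D ^ 2).
  { rewrite Cmod2_alt. unfold phi. rewrite !Hseg.
    replace (z + 1 * d)%C with w by (unfold d; ring).
    replace (z + 0 * d)%C with z by (unfold d; ring).
    unfold D; unfold Re, Im; simpl; ring. }
  destruct (Rle_lt_or_eq_dec _ _ (Cmod_ge_0 D)) as [HD|HD].
  - apply Rmult_le_reg_l with (Cmod D); [exact HD|].
    rewrite Hsq in Hphi. nra.
  - rewrite <- HD. apply Rmult_le_pos; [|apply Cmod_ge_0].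
    eapply Rle_trans; [apply Cmod_ge_0 | now apply (HB z)].
Qed.


(** * Complex derivatives *)

Definition cderiv (f : C -> C) (z l : C) : Prop :=
  forall eps, 0 < eps -> exists delta, 0 < delta /\
    forall w, Cmod (w - z) < delta ->
      Cmod (f w - f z - l * (w - z)) <= eps * Cmod (w - z).

Lemma cderiv_is_derive f z l :
  cderiv f z l -> @is_derive C_AbsRing C_NormedModule f z l.
Proof.
  intros H; split.
  - apply is_linear_scal_l.
  - intros x Hx eps.
    rewrite <- (is_filter_lim_locally_unique _ _ Hx).
    destruct (H eps (cond_pos eps)) as [d [Hd Hw]].
    exists (mkposreal d Hd). intros w Hwz.
    specialize (Hw w Hwz).
    change (Cmod (f w - f z - (w - z) * l) <= eps * Cmod (w - z)).
    now rewrite (Cmult_comm (w - z) l).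
Qed.

Lemma cderiv_C_derive f z l : cderiv f z l -> C_derive f z = l.
Proof. intros H; now apply is_C_derive_unique, cderiv_is_derive. Qed.

(** The derivative is itself a total function known only in the disc, so second
    derivatives need agreement on a neighbourhood only. *)
Lemma cderiv_ext_loc f g z l rho : 0 < rho ->
  (forall w, Cmod (w - z) < rho -> g w = f w) -> cderiv f z l -> cderiv g z l.
Proof.
  intros Hrho Hfg H eps Heps; destruct (H eps Heps) as [d [Hd Hw]].
  exists (Rmin d rho); split; [now apply Rmin_pos|].
  intros w Hwz. assert (Cmod (w - z) < d /\ Cmod (w - z) < rho) as [H1 H2].
  { split; eapply Rlt_le_trans; try exact Hwz; [apply Rmin_l | apply Rmin_r]. }
  rewrite !Hfg; auto. replace (z - z)%C with (RtoC 0) by ring. now rewrite Cmod_0.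
Qed.

Lemma cderiv_const c z : cderiv (fun _ => c) z (RtoC 0).
Proof.
  intros eps Heps; exists 1; split; [lra|]. intros w _.
  replace (c - c - 0 * (w - z))%C with (RtoC 0) by ring. rewrite Cmod_0.
  apply Rmult_le_pos; [lra | apply Cmod_ge_0].
Qed.

Lemma cderiv_id z : cderiv (fun w => w) z (RtoC 1).
Proof.
  intros eps Heps; exists 1; split; [lra|]. intros w _.
  replace (w - z - 1 * (w - z))%C with (RtoC 0) by ring. rewrite Cmod_0.
  apply Rmult_le_pos; [lra | apply Cmod_ge_0].
Qed.

Lemma cderiv_plus f g z l m :
  cderiv f z l -> cderiv g z m -> cderiv (fun w => f w + g w)%C z (l + m)%C.
Proof.
  intros Hf Hg eps Heps.
  destruct (Hf (eps / 2)) as [d1 [Hd1 H1]]; [lra|].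
  destruct (Hg (eps / 2)) as [d2 [Hd2 H2]]; [lra|].
  exists (Rmin d1 d2); split; [now apply Rmin_pos|]. intros w Hw.
  specialize (H1 w (Rlt_le_trans _ _ _ Hw (Rmin_l _ _))).
  specialize (H2 w (Rlt_le_trans _ _ _ Hw (Rmin_r _ _))).
  replace (f w + g w - (f z + g z) - (l + m) * (w - z))%C
    with ((f w - f z - l * (w - z)) + (g w - g z - m * (w - z)))%C by ring.
  eapply Rle_trans; [apply Cmod_triangle|]. lra.
Qed.

Lemma cderiv_local_lipschitz f z l : cderiv f z l ->
  exists L delta, 0 < L /\ 0 < delta /\
    forall w, Cmod (w - z) < delta -> Cmod (f w - f z) <= L * Cmod (w - z).
Proof.
  intros H; destruct (H 1) as [d [Hd Hw]]; [lra|].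
  exists (1 + Cmod l), d; pose proof (Cmod_ge_0 l); repeat split; try lra.
  intros w Hwz; specialize (Hw w Hwz).
  replace (f w - f z)%C with ((f w - f z - l * (w - z)) + l * (w - z))%C by ring.
  eapply Rle_trans; [apply Cmod_triangle|]. rewrite Cmod_mult. lra.
Qed.

Lemma cderiv_mult f g z l m :
  cderiv f z l -> cderiv g z m ->
  cderiv (fun w => f w * g w)%C z (l * g z + f z * m)%C.
Proof.
  intros Hf Hg eps Heps.
  destruct (cderiv_local_lipschitz _ _ _ Hg) as [L [d0 [HL [Hd0 H0]]]].
  pose proof (Cmod_ge_0 (g z)) as Pg; pose proof (Cmod_ge_0 (f z)) as Pf.
  pose proof (Cmod_ge_0 l) as Pl.
  set (M := 1 + Cmod (g z) + Cmod (f z) + Cmod l * L).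
  assert (PlL : 0 <= Cmod l * L) by nra.
  assert (HM : 0 < M) by (unfold M; nra).
  assert (He : 0 < eps / (4 * M)) by (apply Rdiv_lt_0_compat; lra).
  destruct (Hf _ He) as [d1 [Hd1 H1]].
  destruct (Hg _ He) as [d2 [Hd2 H2]].
  exists (Rmin (Rmin d1 d2) (Rmin d0 (Rmin (/ L) (eps / (4 * M))))).
  split; [repeat apply Rmin_pos; auto; now apply Rinv_0_lt_compat|].
  intros w Hw.
  assert (Hw1 : Cmod (w - z) < d1) by (eapply Rlt_le_trans; [exact Hw|]; eapply Rle_trans; apply Rmin_l).
  assert (Hw2 : Cmod (w - z) < d2) by (eapply Rlt_le_trans; [exact Hw|]; eapply Rle_trans; [apply Rmin_l|apply Rmin_r]).
  assert (Hw' : Cmod (w - z) < Rmin d0 (Rmin (/ L) (eps / (4 * M)))) by (eapply Rlt_le_trans; [exact Hw|]; apply Rmin_r).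
  assert (Hw0 : Cmod (w - z) < d0) by (eapply Rlt_le_trans; [exact Hw'|]; apply Rmin_l).
  assert (Hw'' : Cmod (w - z) < Rmin (/ L) (eps / (4 * M))) by (eapply Rlt_le_trans; [exact Hw'|]; apply Rmin_r).
  assert (Hw3 : Cmod (w - z) < / L) by (eapply Rlt_le_trans; [exact Hw''|]; apply Rmin_l).
  assert (Hw4 : Cmod (w - z) < eps / (4 * M)) by (eapply Rlt_le_trans; [exact Hw''|]; apply Rmin_r).
  specialize (H1 w Hw1). specialize (H2 w Hw2). specialize (H0 w Hw0).
  set (h := (w - z)%C) in *. set (e := eps / (4 * M)) in *.
  set (k := (g w - g z)%C) in *.
  pose proof (Cmod_ge_0 h).
  assert (HLh : L * Cmod h <= 1).
  { apply Rmult_le_reg_l with (/ L); [now apply Rinv_0_lt_compat|].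
    rewrite <- Rmult_assoc, Rinv_l, Rmult_1_l, Rmult_1_r by lra. lra. }
  replace (f w * g w - f z * g z - (l * g z + f z * m) * h)%C
    with ((f w - f z - l * h) * g z + (f w - f z - l * h) * k + l * h * k + f z * (k - m * h))%C
    by (unfold k; ring).
  assert (HeM : e * (4 * M) = eps) by (unfold e; field; lra).
  pose proof (Cmod_ge_0 k).
  pose proof (Cmod_ge_0 (f w - f z - l * h)%C).
  assert (T1 : Cmod ((f w - f z - l * h) * g z) <= e * Cmod h * M).
  { rewrite Cmod_mult. apply Rmult_le_compat; auto; unfold M; nra. }
  assert (T2 : Cmod ((f w - f z - l * h) * k) <= e * Cmod h * M).
  { rewrite Cmod_mult. apply Rmult_le_compat; auto; unfold M; nra. }
  assert (T3 : Cmod (l * h * k) <= e * Cmod h * M).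
  { rewrite !Cmod_mult.
    apply Rle_trans with (Cmod l * Cmod h * (L * Cmod h)).
    - apply Rmult_le_compat_l; [now apply Rmult_le_pos | exact H0].
    - replace (Cmod l * Cmod h * (L * Cmod h)) with (Cmod h * ((Cmod l * L) * Cmod h)) by ring.
      replace (e * Cmod h * M) with (Cmod h * (M * e)) by ring.
      apply Rmult_le_compat_l; auto. apply Rmult_le_compat; auto; unfold M; nra. }
  assert (T4 : Cmod (f z * (k - m * h)) <= e * Cmod h * M).
  { rewrite Cmod_mult, Rmult_comm. apply Rmult_le_compat; auto using Cmod_ge_0; unfold M; nra. }
  eapply Rle_trans; [apply Cmod_triangle|].
  eapply Rle_trans; [apply Rplus_le_compat_r, Cmod_triangle|].
  eapply Rle_trans; [apply Rplus_le_compat_r, Rplus_le_compat_r, Cmod_triangle|].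
  rewrite <- HeM. lra.
Qed.

Lemma cderiv_eq f z l l' : l = l' -> cderiv f z l -> cderiv f z l'.
Proof. now intros ->. Qed.

Lemma cderiv_scal (e : R) f z l : cderiv f z l -> cderiv (fun w => RtoC e * f w)%C z (RtoC e * l)%C.
Proof.
  intros H. eapply cderiv_eq; [|apply cderiv_mult; [apply (cderiv_const (RtoC e)) | exact H]]. cbn beta; ring.
Qed.

Lemma cderiv_peval p z : cderiv (peval p) z (peval (pderiv p) z).
Proof.
  induction p; cbn [peval pderiv].
  - apply cderiv_const.
  - induction n as [|n IHn].
    + exact (cderiv_const (RtoC 1) z).
    + change (fun z0 : C => (z0 ^ S n)%C) with (fun z0 : C => (z0 * z0 ^ n)%C).
      eapply cderiv_eq; [|apply cderiv_mult; [apply cderiv_id | exact IHn]].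
      destruct n.
      * simpl; ring.
      * cbn [peval]. rewrite (S_INR (S n)), RtoC_plus, !Cpow_S; ring.
  - now apply cderiv_plus.
  - now apply cderiv_mult.
Qed.

(** * The complex exponential *)

Definition Cexp (z : C) : C := (exp (fst z) * cos (snd z), exp (fst z) * sin (snd z)).

Lemma Cexp_plus z w : Cexp (z + w) = (Cexp z * Cexp w)%C.
Proof.
  unfold Cexp; simpl. rewrite exp_plus, cos_plus, sin_plus.
  apply injective_projections; simpl; ring.
Qed.

Lemma Cmod_Cexp z : Cmod (Cexp z) = exp (fst z).
Proof.
  unfold Cexp, Cmod; simpl.
  replace (_ + _) with (exp (fst z) ^ 2 * ((sin (snd z))² + (cos (snd z))²)) by (unfold Rsqr; ring).
  rewrite sin2_cos2, Rmult_1_r, sqrt_pow2; [easy|]. left; apply exp_pos.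
Qed.

Lemma Cmod_le_abs z : Cmod z <= Rabs (fst z) + Rabs (snd z).
Proof.
  pose proof (Rabs_pos (fst z)); pose proof (Rabs_pos (snd z)).
  apply Rsqr_incr_0_var; [|lra]. unfold Rsqr.
  replace (Cmod z * Cmod z) with (Cmod z ^ 2) by ring.
  rewrite Cmod2_alt. unfold Re, Im.
  rewrite <- (pow2_abs (fst z)), <- (pow2_abs (snd z)). nra.
Qed.

Lemma Rabs_snd_le_Cmod z : Rabs (snd z) <= Cmod z.
Proof. eapply Rle_trans; [apply Rmax_r | apply Rmax_Cmod]. Qed.
Lemma Rabs_fst_le_Cmod z : Rabs (fst z) <= Cmod z.
Proof. eapply Rle_trans; [apply Rmax_l | apply Rmax_Cmod]. Qed.

Lemma exp_taylor1 x : Rabs x <= / 2 -> Rabs (exp x - 1 - x) <= 2 * x ^ 2.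
Proof.
  intros Hx; apply Rabs_le_between in Hx.
  pose proof (exp_ineq1_le x) as Hp. pose proof (exp_ineq1_le (- x)) as Hm.
  rewrite exp_Ropp in Hm. pose proof (exp_pos x) as H0.
  assert (exp x * (1 - x) <= 1).
  { apply Rmult_le_reg_l with (/ exp x); [now apply Rinv_0_lt_compat|].
    rewrite <- Rmult_assoc, Rinv_l by lra. lra. }
  rewrite Rabs_pos_eq by lra. nra.
Qed.

Lemma cos_taylor1 y : 0 <= 1 - cos y <= y ^ 2 / 2.
Proof.
  split; [pose proof (COS_bound y); lra|].
  replace y with (2 * (y / 2)) at 1 by field. rewrite cos_2a_sin.
  assert (sin (y / 2) ^ 2 <= (y / 2) ^ 2); [|nra].
  assert (forall x, 0 <= x -> Rabs (sin x) <= x) as Hs.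
  { intros x [Hx|<-]; [|rewrite sin_0, Rabs_R0; lra].
    destruct (Rle_or_lt x 1).
    - rewrite Rabs_pos_eq; [left; now apply sin_lt_x|]. apply sin_ge_0; [lra|].
      pose proof PI_RGT_0; pose proof PI2_1; lra.
    - pose proof (SIN_bound x). apply Rabs_le; lra. }
  rewrite <- (pow2_abs (sin (y / 2))), <- (pow2_abs (y / 2)).
  apply pow_incr; split; [apply Rabs_pos|].
  destruct (Rle_or_lt 0 (y / 2)).
  - rewrite (Rabs_pos_eq (y / 2)); auto.
  - rewrite (Rabs_left (y / 2)), <- Rabs_Ropp, <- sin_neg by lra. apply Hs; lra.
Qed.

Lemma sin_taylor1 y : Rabs y <= 1 -> Rabs (sin y - y) <= y ^ 2.
Proof.
  intros Hy.
  destruct (MVT_gen (fun t => sin t - t) 0 y (fun t => cos t - 1)) as [xi [Hxi Heq]].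
  { intros; auto_derive; [easy | ring]. }
  { intros t _. apply derivable_continuous_pt. exists (cos t - 1).
    apply is_derive_Reals. auto_derive; [easy | ring]. }
  rewrite sin_0 in Heq. replace (sin y - y) with (sin y - y - (0 - 0)) by ring.
  rewrite Heq, Rminus_0_r, Rabs_mult, <- pow2_abs.
  assert (Rabs (cos xi - 1) <= Rabs y).
  { rewrite Rabs_minus_sym. destruct (cos_taylor1 xi) as [H1 H2].
    rewrite Rabs_pos_eq by lra.
    assert (Rabs xi <= Rabs y).
    { unfold Rmin, Rmax in Hxi. destruct (Rle_dec 0 y).
      - rewrite !Rabs_pos_eq; lra.
      - rewrite !Rabs_left1; lra. }
    rewrite <- pow2_abs in H2. pose proof (Rabs_pos xi). nra. }
  pose proof (Rabs_pos y); nra.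
Qed.

Lemma Cexp_taylor1 h : Cmod h <= / 2 -> Cmod (Cexp h - 1 - h) <= 16 * Cmod h ^ 2.
Proof.
  intros Hh. pose proof (Rabs_fst_le_Cmod h) as Hx; pose proof (Rabs_snd_le_Cmod h) as Hy.
  destruct h as [x y]; cbn [fst snd] in *. set (H := Cmod (x, y)) in *.
  assert (H0 : 0 <= H) by apply Cmod_ge_0.
  pose proof (exp_taylor1 x ltac:(lra)) as He.
  pose proof (cos_taylor1 y) as Hc.
  pose proof (sin_taylor1 y ltac:(lra)) as Hs.
  assert (x ^ 2 <= H ^ 2) by (rewrite <- pow2_abs; apply pow_incr; split; [apply Rabs_pos | auto]).
  assert (y ^ 2 <= H ^ 2) by (rewrite <- pow2_abs; apply pow_incr; split; [apply Rabs_pos | auto]).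
  assert (Hexp : 0 < exp x <= 2).
  { split; [apply exp_pos|]. apply Rabs_le_between in He.
    apply Rabs_le_between in Hx. nra. }
  assert (He1 : Rabs (exp x - 1) <= 2 * H).
  { replace (exp x - 1) with ((exp x - 1 - x) + x) by ring.
    eapply Rle_trans; [apply Rabs_triang|]. nra. }
  eapply Rle_trans; [apply Cmod_le_abs|].
  unfold Cexp; simpl.
  replace (exp x * cos y + - (1) + - x) with ((exp x - 1 - x) + exp x * (- (1 - cos y))) by ring.
  replace (exp x * sin y + - 0 + - y) with (exp x * (sin y - y) + (exp x - 1) * y) by ring.
  eapply Rle_trans; [apply Rplus_le_compat; apply Rabs_triang|].
  rewrite !Rabs_mult, Rabs_Ropp, (Rabs_pos_eq (exp x)), (Rabs_pos_eq (1 - cos y)) by lra.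
  pose proof (Rabs_pos (sin y - y)); pose proof (Rabs_pos y); pose proof (Rabs_pos (exp x - 1)).
  assert (exp x * (1 - cos y) <= 2 * (H ^ 2)) by (apply Rmult_le_compat; lra).
  assert (exp x * Rabs (sin y - y) <= 2 * (H ^ 2)) by (apply Rmult_le_compat; lra).
  assert (Rabs (exp x - 1) * Rabs y <= 2 * H * H) by (apply Rmult_le_compat; lra).
  simpl in *; lra.
Qed.

(** By the functional equation only the expansion of the exponential at 0
    matters, with the increment of [f] as its argument. *)
Lemma cderiv_Cexp_comp f z l :
  cderiv f z l -> cderiv (fun w => Cexp (f w)) z (l * Cexp (f z))%C.
Proof.
  intros Hf eps Heps.
  destruct (cderiv_local_lipschitz _ _ _ Hf) as [L [d0 [HL [Hd0 H0]]]].
  set (E := exp (fst (f z))). assert (HE : 0 < E) by apply exp_pos.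
  destruct (Hf (eps / (2 * E))) as [d1 [Hd1 H1]].
  { apply Rdiv_lt_0_compat; lra. }
  assert (HA : 0 < / (2 * L)) by (apply Rinv_0_lt_compat; lra).
  assert (HLL : 0 < 32 * E * (L * L)) by (repeat apply Rmult_lt_0_compat; lra).
  assert (HB : 0 < eps / (32 * E * (L * L))) by (apply Rdiv_lt_0_compat; lra).
  exists (Rmin (Rmin d0 d1) (Rmin (/ (2 * L)) (eps / (32 * E * (L * L))))).
  split; [now repeat apply Rmin_pos|].
  intros w Hw.
  assert (Hw0 : Cmod (w - z) < d0) by (eapply Rlt_le_trans; [exact Hw|]; eapply Rle_trans; apply Rmin_l).
  assert (Hw1 : Cmod (w - z) < d1) by (eapply Rlt_le_trans; [exact Hw|]; eapply Rle_trans; [apply Rmin_l|apply Rmin_r]).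
  assert (Hw2 : Cmod (w - z) < / (2 * L)) by (eapply Rlt_le_trans; [exact Hw|]; eapply Rle_trans; [apply Rmin_r|apply Rmin_l]).
  assert (Hw3 : Cmod (w - z) < eps / (32 * E * (L * L))) by (eapply Rlt_le_trans; [exact Hw|]; eapply Rle_trans; apply Rmin_r).
  specialize (H0 w Hw0); specialize (H1 w Hw1).
  set (h := (w - z)%C) in *. set (k := (f w - f z)%C) in *.
  pose proof (Cmod_ge_0 h); pose proof (Cmod_ge_0 k).
  assert (Hk : Cmod k <= / 2).
  { eapply Rle_trans; [exact H0|].
    apply Rmult_le_reg_l with (/ L); [now apply Rinv_0_lt_compat|].
    rewrite <- Rmult_assoc, Rinv_l, Rmult_1_l by lra.
    rewrite <- Rinv_mult, (Rmult_comm L 2). lra. }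
  replace (Cexp (f w)) with (Cexp (f z) * Cexp k)%C
    by (rewrite <- Cexp_plus; f_equal; unfold k; ring).
  replace (Cexp (f z) * Cexp k - Cexp (f z) - l * Cexp (f z) * h)%C
    with (Cexp (f z) * ((Cexp k - 1 - k) + (k - l * h)))%C by ring.
  rewrite Cmod_mult, Cmod_Cexp. fold E.
  assert (Cmod ((Cexp k - 1 - k) + (k - l * h)) <= (eps / E) * Cmod h).
  { eapply Rle_trans; [apply Cmod_triangle|].
    pose proof (Cexp_taylor1 k Hk).
    assert (16 * Cmod k ^ 2 <= eps / (2 * E) * Cmod h).
    { apply Rle_trans with (16 * (L * Cmod h) ^ 2).
      - apply Rmult_le_compat_l; [lra|]. apply pow_incr; lra.
      - replace (16 * (L * Cmod h) ^ 2) with (16 * (L * L) * Cmod h * Cmod h) by ring.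
        apply Rmult_le_compat_r; auto.
        apply Rle_trans with (16 * (L * L) * (eps / (32 * E * (L * L)))).
        + apply Rmult_le_compat_l; [nra | lra].
        + right; field; lra. }
    replace (eps / E) with (eps / (2 * E) + eps / (2 * E)) by (field; lra).
    lra. }
  apply Rle_trans with (E * (eps / E * Cmod h)).
  - apply Rmult_le_compat_l; lra.
  - right; field; lra.
Qed.


(** * Locally uniform limits of polynomials *)

Definition Clim (u : nat -> C) : C :=
  (real (Lim_seq (fun n => Re (u n))), real (Lim_seq (fun n => Im (u n)))).

Lemma half_pow_pos n : 0 < (/ 2) ^ n.
Proof. apply pow_lt; lra. Qed.

Lemma half_pow_small eps : 0 < eps -> exists N, forall n, (N <= n)%nat -> (/ 2) ^ n < eps.
Proof.
  intros He. destruct (pow_lt_1_zero (/ 2) ltac:(rewrite Rabs_pos_eq; lra) eps He) as [N HN].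
  exists N; intros n Hn. specialize (HN n Hn). rewrite Rabs_pos_eq in HN; auto.
  left; apply half_pow_pos.
Qed.

Section GeometricLimit.

Variables (u : nat -> C) (J : nat).
Hypothesis Hu : forall j, (J <= j)%nat -> Cmod (u (S j) - u j) <= (/ 2) ^ j.

Lemma geometric_cauchy m n : (J <= m)%nat -> (m <= n)%nat ->
  Cmod (u n - u m) <= 2 * (/ 2) ^ m - 2 * (/ 2) ^ n.
Proof.
  intros Hm Hn; induction Hn as [|n Hn IH].
  - replace (u m - u m)%C with (RtoC 0) by ring. rewrite Cmod_0; lra.
  - replace (u (S n) - u m)%C with ((u (S n) - u n) + (u n - u m))%C by ring.
    eapply Rle_trans; [apply Cmod_triangle|].
    specialize (Hu n ltac:(lia)). simpl; lra.
Qed.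

Lemma geometric_component (c : C -> R) :
  (forall z w, c (z - w)%C = c z - c w) -> (forall z, Rabs (c z) <= Cmod z) ->
  is_lim_seq (fun n => c (u n)) (real (Lim_seq (fun n => c (u n)))).
Proof.
  intros Hc Hcm. apply Lim_seq_correct', ex_lim_seq_cauchy_corr.
  intros eps.
  destruct (half_pow_small (eps / 4)) as [N HN]; [pose proof (cond_pos eps); lra|].
  assert (K : forall n m, (max N J <= n)%nat -> (n <= m)%nat -> Rabs (c (u n) - c (u m)) < eps).
  { intros n m Hn Hm. rewrite Rabs_minus_sym, <- Hc.
    eapply Rle_lt_trans; [apply Hcm|].
    pose proof (geometric_cauchy n m ltac:(lia) Hm).
    specialize (HN n ltac:(lia)). pose proof (half_pow_pos m); pose proof (cond_pos eps). lra. }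
  exists (max N J); intros n m Hn Hm.
  destruct (Nat.le_ge_cases n m).
  - now apply K.
  - rewrite Rabs_minus_sym; now apply K.
Qed.

Lemma geometric_limit eps : 0 < eps -> exists N, forall n, (N <= n)%nat ->
  Cmod (Clim u - u n) < eps.
Proof.
  intros He.
  assert (Hr : is_lim_seq (fun n => Re (u n)) (Re (Clim u))).
  { apply (geometric_component Re); [intros; unfold Re; simpl; ring | apply Rabs_fst_le_Cmod]. }
  assert (Hi : is_lim_seq (fun n => Im (u n)) (Im (Clim u))).
  { apply (geometric_component Im); [intros; unfold Im; simpl; ring | apply Rabs_snd_le_Cmod]. }
  apply is_lim_seq_Reals in Hr; apply is_lim_seq_Reals in Hi.
  destruct (Hr (eps / 2)) as [N1 H1]; [lra|].
  destruct (Hi (eps / 2)) as [N2 H2]; [lra|].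
  exists (max N1 N2); intros n Hn.
  specialize (H1 n ltac:(lia)). specialize (H2 n ltac:(lia)).
  unfold Rdist in H1, H2.
  rewrite Cmod_sub_comm.
  eapply Rle_lt_trans; [apply Cmod_le_abs|].
  replace (fst (u n - Clim u)%C) with (Re (u n) - Re (Clim u)) by (unfold Re; simpl; ring).
  replace (snd (u n - Clim u)%C) with (Im (u n) - Im (Clim u)) by (unfold Im; simpl; ring).
  lra.
Qed.

Lemma geometric_limit_bound m : (J <= m)%nat -> Cmod (Clim u - u m) <= 2 * (/ 2) ^ m.
Proof.
  intros Hm. apply le_epsilon; intros eps He.
  destruct (geometric_limit eps He) as [N HN].
  specialize (HN (max N m) ltac:(lia)).
  pose proof (geometric_cauchy m (max N m) Hm ltac:(lia)).
  pose proof (half_pow_pos (max N m)).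
  replace (Clim u - u m)%C with ((Clim u - u (max N m)) + (u (max N m) - u m))%C by ring.
  eapply Rle_trans; [apply Cmod_triangle|]. lra.
Qed.

End GeometricLimit.

Fixpoint pderivn (i : nat) (p : cpoly) : cpoly :=
  match i with O => p | S i => pderiv (pderivn i p) end.

Section PolyLimit.

Variables (p : nat -> cpoly) (r : nat -> R) (k : nat).
Hypothesis r_incr : forall j, r j <= r (S j).
Hypothesis r_lim : forall rho, rho < 1 -> exists j, rho < r j.
Hypothesis p_close : forall j i z, (i <= k)%nat -> Cmod z <= r j ->
  Cmod (peval (pderivn i (p (S j))) z - peval (pderivn i (p j)) z) <= (/ 2) ^ j.

Definition plim (i : nat) (z : C) : C := Clim (fun j => peval (pderivn i (p j)) z).

Lemma r_mono i j : (i <= j)%nat -> r i <= r j.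
Proof. induction 1; [lra|]. specialize (r_incr m); lra. Qed.

Lemma plim_bound i z j : (i <= k)%nat -> Cmod z <= r j ->
  Cmod (plim i z - peval (pderivn i (p j)) z) <= 2 * (/ 2) ^ j.
Proof.
  intros Hi Hz. apply (geometric_limit_bound (fun j => peval (pderivn i (p j)) z) j); auto.
  intros l Hl. apply p_close; auto. pose proof (r_mono j l Hl); lra.
Qed.

Lemma plim_approx i z eps : (i <= k)%nat -> Cmod z < 1 -> 0 < eps ->
  exists N, forall n, (N <= n)%nat -> Cmod (plim i z - peval (pderivn i (p n)) z) < eps.
Proof.
  intros Hi Hz He. destruct (r_lim _ Hz) as [j Hj].
  apply (geometric_limit (fun j => peval (pderivn i (p j)) z) j); auto.
  intros l Hl. apply p_close; auto. pose proof (r_mono j l Hl); lra.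
Qed.

Lemma poly_diff_lipschitz i m n z w : (S i <= k)%nat -> (m <= n)%nat ->
  Cmod z <= r m -> Cmod w <= r m ->
  Cmod ((peval (pderivn i (p n)) w - peval (pderivn i (p m)) w) - (peval (pderivn i (p n)) z - peval (pderivn i (p m)) z))
  <= 2 * (/ 2) ^ m * Cmod (w - z).
Proof.
  intros Hi Hmn Hz Hw.
  set (d := Padd (pderivn i (p n)) (Pmul (Pconst (-1)) (pderivn i (p m)))).
  replace (peval (pderivn i (p n)) w - peval (pderivn i (p m)) w)%C with (peval d w) by (unfold d; simpl; ring).
  replace (peval (pderivn i (p n)) z - peval (pderivn i (p m)) z)%C with (peval d z) by (unfold d; simpl; ring).
  apply (peval_mean_value d (r m)); auto.
  intros v Hv.
  replace (peval (pderiv d) v) with (peval (pderivn (S i) (p n)) v - peval (pderivn (S i) (p m)) v)%C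
    by (unfold d; simpl; ring).
  pose proof (geometric_cauchy (fun j => peval (pderivn (S i) (p j)) v) m) as G.
  pose proof (half_pow_pos n).
  eapply Rle_trans; [apply G; auto|lra].
  intros j Hj. apply p_close; auto. pose proof (r_mono m j Hj); lra.
Qed.

(** The increments of the tail are controlled by the mean value inequality, so
    the error in the linear approximation of the limit is that of one
    polynomial up to a factor that is arbitrarily small. *)
Lemma plim_cderiv i z : (S i <= k)%nat -> Cmod z < 1 ->
  cderiv (plim i) z (plim (S i) z).
Proof.
  intros Hi Hz eps He.
  destruct (r_lim ((1 + Cmod z) / 2)) as [j0 Hj0]; [lra|].
  destruct (half_pow_small (eps / 8)) as [N HN]; [lra|].
  (* the error at stage m stays small on a disc that contains a neighbourhood of z *)
  set (m := max j0 N).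
  assert (Hrm : (1 + Cmod z) / 2 < r m) by (pose proof (r_mono j0 m ltac:(lia)); lra).
  specialize (HN m ltac:(lia)).
  destruct (cderiv_peval (pderivn i (p m)) z (eps / 4)) as [d [Hd Hw]]; [lra|].
  exists (Rmin d ((1 - Cmod z) / 2)). split; [apply Rmin_pos; lra|].
  intros w Hwz.
  assert (Hwd : Cmod (w - z) < d) by (eapply Rlt_le_trans; [exact Hwz | apply Rmin_l]).
  assert (Hwr : Cmod (w - z) < (1 - Cmod z) / 2) by (eapply Rlt_le_trans; [exact Hwz | apply Rmin_r]).
  specialize (Hw w Hwd).
  assert (Hwm : Cmod w <= (1 + Cmod z) / 2).
  { replace w with ((w - z) + z)%C by ring. eapply Rle_trans; [apply Cmod_triangle|]. lra. }
  change (pderiv (pderivn i (p m))) with (pderivn (S i) (p m)) in Hw.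
  set (E := fun j v => peval (pderivn i (p j)) v) in *.
  change (peval (pderivn i (p m)) w) with (E m w) in Hw.
  change (peval (pderivn i (p m)) z) with (E m z) in Hw.
  set (E' := fun j v => peval (pderivn (S i) (p j)) v) in *.
  change (peval (pderivn (S i) (p m)) z) with (E' m z) in Hw.
  assert (HL : forall v, Cmod v <= r m -> Cmod v < 1 ->
    Cmod ((plim i v - E m v) - (plim i z - E m z)) <= 2 * (/ 2) ^ m * Cmod (v - z)).
  { intros v Hv Hv1. apply le_epsilon; intros e Hepos.
    destruct (plim_approx i v (e / 2)) as [N1 HN1]; [lia|auto|lra|].
    destruct (plim_approx i z (e / 2)) as [N2 HN2]; [lia|auto|lra|].
    set (n := max m (max N1 N2)).
    specialize (HN1 n ltac:(lia)). specialize (HN2 n ltac:(lia)).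
    pose proof (poly_diff_lipschitz i m n z v Hi ltac:(lia) ltac:(lra) Hv) as HP.
    fold (E n v) (E n z) (E m v) (E m z) in *.
    change (peval (pderivn i (p n)) v) with (E n v) in *. change (peval (pderivn i (p n)) z) with (E n z) in *.
    change (peval (pderivn i (p m)) v) with (E m v) in *. change (peval (pderivn i (p m)) z) with (E m z) in *.
    replace (plim i v - E m v - (plim i z - E m z))%C
      with ((plim i v - E n v) + - (plim i z - E n z) + ((E n v - E m v) - (E n z - E m z)))%C by ring.
    eapply Rle_trans; [apply Cmod_triangle|].
    eapply Rle_trans; [apply Rplus_le_compat_r, Cmod_triangle|].
    rewrite Cmod_opp. lra. }
  specialize (HL w ltac:(lra) ltac:(lra)).
  pose proof (plim_bound (S i) z m ltac:(lia) ltac:(lra)) as HD.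
  fold (E' m z) in HD. change (peval (pderivn (S i) (p m)) z) with (E' m z) in HD.
  replace (plim i w - plim i z - plim (S i) z * (w - z))%C
    with (((plim i w - E m w) - (plim i z - E m z)) + - ((plim (S i) z - E' m z) * (w - z))
          + (E m w - E m z - E' m z * (w - z)))%C by ring.
  eapply Rle_trans; [apply Cmod_triangle|].
  eapply Rle_trans; [apply Rplus_le_compat_r, Cmod_triangle|].
  rewrite Cmod_opp, Cmod_mult.
  pose proof (Cmod_ge_0 (w - z)).
  assert (0 <= eps * Cmod (w - z)) by (apply Rmult_le_pos; lra).
  assert (Cmod (plim (S i) z - E' m z) * Cmod (w - z) <= 2 * (/ 2) ^ m * Cmod (w - z))
    by (apply Rmult_le_compat_r; auto).
  assert ((/ 2) ^ m * Cmod (w - z) <= eps / 8 * Cmod (w - z)) by (apply Rmult_le_compat_r; lra).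
  lra.
Qed.

End PolyLimit.


(** * Integrals over the circle and oscillation *)

Definition cont_diff (u : R -> R) : Prop :=
  exists u', (forall t, is_derive u t (u' t)) /\ (forall t, continuous u' t).

Lemma cont_diff_continuous u t : cont_diff u -> continuous u t.
Proof.
  intros [u' [Hu _]]. apply @ex_derive_continuous. now exists (u' t).
Qed.

Lemma cont_diff_const c : cont_diff (fun _ => c).
Proof.
  exists (fun _ => 0); split; intros t; [apply @is_derive_const | apply continuous_const].
Qed.

Lemma cont_diff_plus u v : cont_diff u -> cont_diff v -> cont_diff (fun t => u t + v t).
Proof.
  intros [u' [Hu Cu]] [v' [Hv Cv]]. exists (fun t => u' t + v' t); split; intros t.
  - now apply @is_derive_plus.
  - now apply @continuous_plus.
Qed.

Lemma cont_diff_mult u v : cont_diff u -> cont_diff v -> cont_diff (fun t => u t * v t).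
Proof.
  intros Hu0 Hv0. pose proof (fun t => cont_diff_continuous _ t Hu0) as Ku.
  pose proof (fun t => cont_diff_continuous _ t Hv0) as Kv.
  destruct Hu0 as [u' [Hu Cu]], Hv0 as [v' [Hv Cv]].
  exists (fun t => u' t * v t + u t * v' t); split; intros t.
  - apply (is_derive_mult (K := R_AbsRing)); auto. intros; apply Rmult_comm.
  - apply @continuous_plus; apply @continuous_mult; auto.
Qed.

Lemma cont_diff_comp phi u : cont_diff phi -> cont_diff u -> cont_diff (fun t => phi (u t)).
Proof.
  intros [phi' [Hp Cp]] Hu0. pose proof (fun t => cont_diff_continuous _ t Hu0) as Ku.
  destruct Hu0 as [u' [Hu Cu]].
  exists (fun t => u' t * phi' (u t)); split; intros t.
  - now apply @is_derive_comp.
  - apply @continuous_mult; auto. now apply continuous_comp.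
Qed.

Lemma cont_diff_pow u n : cont_diff u -> cont_diff (fun t => u t ^ n).
Proof.
  intros Hu; induction n; simpl; [apply cont_diff_const | now apply cont_diff_mult].
Qed.

Lemma cont_diff_cos a : cont_diff (fun t => cos (a * t)).
Proof.
  exists (fun t => - (a * sin (a * t))); split; intros t.
  - auto_derive; [easy | ring].
  - apply @ex_derive_continuous. auto_derive; easy.
Qed.

Lemma cont_diff_ext u v : (forall t, u t = v t) -> cont_diff u -> cont_diff v.
Proof.
  intros E [u' [Hu Cu]]; exists u'; split; auto.
  intros t; now apply (is_derive_ext u).
Qed.

Definition circle_int (u : R -> R) : R := RInt u 0 (2 * PI).

Lemma two_pi_pos : 0 < 2 * PI.
Proof. pose proof PI_RGT_0; lra. Qed.

Lemma ex_circle_int (u : R -> R) : (forall t, continuous u t) -> ex_RInt u 0 (2 * PI).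
Proof. intros H; apply (ex_RInt_continuous (V := R_CompleteNormedModule)); auto. Qed.

Lemma circle_int_le (u v : R -> R) : (forall t, continuous u t) -> (forall t, continuous v t) ->
  (forall t, u t <= v t) -> circle_int u <= circle_int v.
Proof.
  intros Hu Hv H. apply RInt_le; auto using ex_circle_int. left; apply two_pi_pos.
Qed.

Lemma circle_int_plus (u v : R -> R) : (forall t, continuous u t) -> (forall t, continuous v t) ->
  circle_int (fun t => u t + v t) = circle_int u + circle_int v.
Proof. intros; apply (RInt_plus (V := R_CompleteNormedModule)); now apply ex_circle_int. Qed.

Lemma circle_int_scal c (u : R -> R) : (forall t, continuous u t) ->
  circle_int (fun t => c * u t) = c * circle_int u.
Proof. intros; apply (RInt_scal (V := R_CompleteNormedModule)); now apply ex_circle_int. Qed.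

Lemma circle_int_const c : circle_int (fun _ => c) = 2 * PI * c.
Proof. unfold circle_int; rewrite RInt_const. unfold scal; simpl; unfold mult; simpl; ring. Qed.

Lemma circle_int_ext u v : (forall t, u t = v t) -> circle_int u = circle_int v.
Proof. intros H; apply RInt_ext; auto. Qed.

(** Integrating by parts: the boundary terms vanish because the sine of an
    integer multiple of a full turn does. *)
Lemma riemann_lebesgue u eps : cont_diff u -> 0 < eps ->
  exists n0, forall n, (n0 <= n)%nat -> Rabs (circle_int (fun t => u t * cos (INR n * t))) <= eps.
Proof.
  intros Hu0 He. pose proof (fun t => cont_diff_continuous _ t Hu0) as Ku.
  destruct Hu0 as [u' [Hu Cu]].
  set (D := circle_int (fun t => Rabs (u' t))).
  assert (Cabs : forall t, continuous (fun t => Rabs (u' t)) t).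
  { intros t. apply (continuous_comp u' Rabs); auto. apply continuous_Rabs. }
  destruct (INR_unbounded (D / eps)) as [n0 Hn0].
  exists (S n0); intros n Hn.
  assert (Hpos : 0 < INR n) by (apply lt_0_INR; lia).
  assert (Csin : forall t, continuous (fun t => sin (INR n * t)) t).
  { intros t; apply @ex_derive_continuous; auto_derive; easy. }
  assert (Ccos : forall t, continuous (fun t => cos (INR n * t)) t).
  { intros t; apply @ex_derive_continuous; auto_derive; easy. }
  assert (Cuc : forall t, continuous (fun t => u t * cos (INR n * t)) t).
  { intros t; apply @continuous_mult; auto. }
  assert (Cus : forall t, continuous (fun t => u' t * sin (INR n * t)) t).
  { intros t; apply @continuous_mult; auto. }
  assert (Hparts : INR n * circle_int (fun t => u t * cos (INR n * t)) + circle_int (fun t => u' t * sin (INR n * t)) = 0).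
  { rewrite <- circle_int_scal, <- circle_int_plus by (auto; intros; apply @continuous_mult; auto using continuous_const).
    unfold circle_int. apply is_RInt_unique.
    evar_last.
    - apply (is_RInt_derive (fun t => u t * sin (INR n * t))).
      + intros t _. evar_last.
        { apply (is_derive_mult (K := R_AbsRing)); [apply Hu | | intros; apply Rmult_comm].
          assert (is_derive (fun t => sin (INR n * t)) t (INR n * cos (INR n * t))) as H
            by (auto_derive; [easy | ring]).
          exact H. }
        unfold plus, mult; simpl. ring.
      + intros t _. apply @continuous_plus; auto. apply @continuous_mult; auto using continuous_const.
    - rewrite Rmult_0_r, sin_0.
      replace (INR n * (2 * PI)) with (0 + 2 * INR n * PI) by ring.
      rewrite sin_period, sin_0. unfold minus, plus, opp; simpl; ring. }
  assert (Hs : Rabs (circle_int (fun t => u' t * sin (INR n * t))) <= D).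
  { eapply Rle_trans; [apply abs_RInt_le; [left; apply two_pi_pos | now apply ex_circle_int]|].
    apply circle_int_le; auto.
    - intros t. apply (continuous_comp (fun t => u' t * sin (INR n * t)) Rabs); auto. apply continuous_Rabs.
    - intros t. rewrite Rabs_mult.
      assert (Rabs (sin (INR n * t)) <= 1) by (apply Rabs_le, SIN_bound).
      pose proof (Rabs_pos (u' t)); nra. }
  apply Rmult_le_reg_l with (INR n); auto.
  rewrite <- (Rabs_pos_eq (INR n)) at 1 by lra. rewrite <- Rabs_mult.
  replace (INR n * circle_int (fun t => u t * cos (INR n * t))) with (- circle_int (fun t => u' t * sin (INR n * t))) by lra.
  rewrite Rabs_Ropp. eapply Rle_trans; [exact Hs|].
  assert (INR n0 <= INR n) by (apply le_INR; lia).
  assert (D = D / eps * eps) by (field; lra). nra.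
Qed.

(** * The convex test function *)

Definition Phi (x : R) : R := sqrt (1 + x ^ 2).
Definition dPhi (x : R) : R := x / sqrt (1 + x ^ 2).
Definition curv (x : R) : R := / (4 * (1 + x ^ 2) ^ 2).

Lemma Phi_sq x : Phi x * Phi x = 1 + x ^ 2.
Proof. apply sqrt_sqrt. nra. Qed.

Lemma Phi_ge_1 x : 1 <= Phi x.
Proof. rewrite <- sqrt_1 at 1. apply sqrt_le_1_alt. nra. Qed.

Lemma Phi_le x : Phi x <= 1 + Rabs x.
Proof.
  pose proof (Rabs_pos x). apply Rsqr_incr_0_var; [|lra].
  unfold Rsqr. rewrite Phi_sq, <- (pow2_abs x). nra.
Qed.

Lemma Rabs_le_Phi x : Rabs x <= Phi x.
Proof.
  pose proof (Phi_ge_1 x). apply Rsqr_incr_0_var; [|lra].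
  unfold Rsqr. rewrite Phi_sq, <- (pow2_abs x). nra.
Qed.

(** A quantitative form of convexity. With s = Phi x and t = Phi (x + h) the
    remainder of the tangent is (t s - (1 + x (x + h))) / s, and
    (t s)^2 - (1 + x (x + h))^2 = h^2; finally t <= 2 s for |h| <= 1. *)
Lemma Phi_taylor x h : Rabs h <= 1 ->
  Phi x + dPhi x * h + curv x * h ^ 2 <= Phi (x + h).
Proof.
  intros Hh. unfold dPhi. fold (Phi x).
  set (s := Phi x). set (t := Phi (x + h)).
  pose proof (Phi_ge_1 x) as Hs1. pose proof (Phi_ge_1 (x + h)) as Ht1.
  pose proof (Phi_sq x) as Hs. pose proof (Phi_sq (x + h)) as Ht.
  fold s in Hs1, Hs. fold t in Ht1, Ht.
  assert (Hts : t <= 2 * s).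
  { apply Rsqr_incr_0_var; [|lra]. unfold Rsqr.
    replace (2 * s * (2 * s)) with (4 * (s * s)) by ring. rewrite Hs, Ht.
    apply Rabs_le_between in Hh.
    assert (h ^ 2 <= 1) by nra. assert (0 <= (x - h) ^ 2) by apply pow2_ge_0. nra. }
  assert (Hk : curv x = / (4 * (s * s) ^ 2)) by (unfold curv; now rewrite Hs).
  rewrite Hk.
  set (a := 1 + x * (x + h)).
  assert (Hdiff : (t * s) * (t * s) - a * a = h ^ 2).
  { replace (t * s * (t * s)) with ((t * t) * (s * s)) by ring. rewrite Hs, Ht. unfold a; ring. }
  assert (Hts1 : 1 <= t * s) by nra.
  assert (Ha : h ^ 2 / (2 * (t * s)) <= t * s - a).
  { apply Rmult_le_reg_r with (2 * (t * s)); [lra|].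
    replace (h ^ 2 / (2 * (t * s)) * (2 * (t * s))) with (h ^ 2) by (field; nra).
    rewrite <- Hdiff. nra. }
  assert (E : t - (s + x / s * h) = (t * s - a) / s).
  { unfold a. apply Rmult_eq_reg_r with s; [|lra]. field_simplify; [|lra|lra].
    replace (s ^ 2) with (1 + x ^ 2) by (rewrite <- Hs; ring). ring. }
  assert (F : / (4 * (s * s) ^ 2) * h ^ 2 <= (t * s - a) / s).
  { apply Rle_trans with (h ^ 2 / (2 * (t * s)) / s).
    - unfold Rdiv. rewrite Rmult_assoc, <- Rinv_mult, Rmult_comm.
      apply Rmult_le_compat_l; [nra|].
      apply Rinv_le_contravar; [nra|].
      replace (4 * (s * s) ^ 2) with (2 * s * (s * s) * (2 * s)) by ring.
      replace (2 * (t * s) * s) with (2 * t * (s * s)) by ring.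
      assert (1 <= s * s) by nra.
      apply Rle_trans with (2 * s * (s * s) * 2); [nra|].
      apply Rmult_le_compat_l; [nra | lra].
    - apply Rmult_le_compat_r; [left; apply Rinv_0_lt_compat; lra | exact Ha]. }
  lra.
Qed.

Lemma cont_diff_Phi : cont_diff Phi.
Proof.
  exists dPhi; split; intros t; unfold Phi, dPhi.
  - auto_derive; [nra|]. simpl. field. apply Rgt_not_eq, sqrt_lt_R0; nra.
  - apply @ex_derive_continuous. auto_derive. split; [nra|]. split; [|easy].
    apply Rgt_not_eq, sqrt_lt_R0; nra.
Qed.

Lemma cont_diff_dPhi : cont_diff dPhi.
Proof.
  exists (fun x => / ((1 + x ^ 2) * sqrt (1 + x ^ 2))); split; intros t; unfold dPhi.
  - assert (0 < 1 + t * (t * 1)) as Hp by nra. pose proof (sqrt_lt_R0 _ Hp) as Hs.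
    auto_derive; [repeat split; auto; lra|].
    simpl in *. pose proof (sqrt_sqrt (1 + t * (t * 1)) ltac:(lra)) as Hq.
    set (s := sqrt (1 + t * (t * 1))) in *. rewrite <- Hq. field_simplify; [|lra|lra].
    f_equal. replace (s ^ 2) with (s * s) by ring. rewrite Hq. ring.
  - assert (0 < 1 + t * (t * 1)) as Hp by nra. pose proof (sqrt_lt_R0 _ Hp) as Hs.
    apply @ex_derive_continuous. auto_derive. repeat split; auto. simpl in *; nra.
Qed.

Lemma cont_diff_curv : cont_diff curv.
Proof.
  exists (fun x => - (4 * (2 * (1 + x ^ 2) * (2 * x))) / (4 * (1 + x ^ 2) ^ 2) ^ 2); split; intros t; unfold curv.
  - assert (0 < 1 + t * (t * 1)) as Hp by nra.
    auto_derive; [nra|]. simpl; field; nra.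
  - apply @ex_derive_continuous. auto_derive. assert (0 < 1 + t * (t * 1)) by nra.
    repeat apply Rmult_integral_contrapositive_currified; lra.
Qed.

(** The linear term of the expansion and the mean of X oscillate with
    frequency n, hence integrate to almost 0; in the quadratic term
    cos^2 = (1 + cos 2) / 2 leaves half of the mean of curv(X) T^2. *)
Lemma oscillation_gain X T eps : cont_diff X -> cont_diff T -> (forall t, Rabs (T t) <= 1) -> 0 < eps ->
  exists n0, forall n, (n0 <= n)%nat ->
    let Y := fun t => X t + T t * cos (INR n * t) in
    circle_int (fun t => Phi (X t)) + / 2 * circle_int (fun t => curv (X t) * T t ^ 2) - eps
      <= circle_int (fun t => Phi (Y t)) /\
    Rabs (circle_int Y - circle_int X) <= eps.
Proof.
  intros HX HT HT1 He.
  assert (H1 : cont_diff (fun t => dPhi (X t) * T t)) by (apply cont_diff_mult; [apply cont_diff_comp|]; auto using cont_diff_dPhi).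
  assert (H2 : cont_diff (fun t => curv (X t) * T t ^ 2)) by (apply cont_diff_mult; [apply cont_diff_comp|apply cont_diff_pow]; auto using cont_diff_curv).
  assert (H3 : cont_diff (fun t => Phi (X t))) by (apply cont_diff_comp; auto using cont_diff_Phi).
  destruct (riemann_lebesgue _ (eps / 2) H1) as [n1 N1]; [lra|].
  destruct (riemann_lebesgue _ (eps / 2) H2) as [n2 N2]; [lra|].
  destruct (riemann_lebesgue _ eps HT) as [n3 N3]; [lra|].
  exists (max n1 (max n2 n3)); intros n Hn Y.
  specialize (N1 n ltac:(lia)). specialize (N2 (2 * n)%nat ltac:(lia)). specialize (N3 n ltac:(lia)).
  assert (Hc : forall a u, cont_diff u -> cont_diff (fun t => u t * cos (a * t))) by (intros; apply cont_diff_mult; auto using cont_diff_cos).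
  assert (Hs : forall a u, cont_diff u -> cont_diff (fun t => a * u t)) by (intros; apply cont_diff_mult; auto using cont_diff_const).
  pose proof (fun u (H : cont_diff u) t => cont_diff_continuous u t H) as Cc.
  pose proof (cont_diff_plus _ _ HX (Hc (INR n) _ HT)) as HY. fold Y in HY.
  split.
  - set (L := fun t => Phi (X t) + (dPhi (X t) * T t * cos (INR n * t) +
       (/ 2 * (curv (X t) * T t ^ 2) + / 2 * (curv (X t) * T t ^ 2 * cos (INR (2 * n) * t))))).
    pose proof (Hc (INR n) _ H1) as K1. pose proof (Hs (/ 2) _ H2) as K2.
    pose proof (Hc (INR (2 * n)) _ H2) as K3. pose proof (Hs (/ 2) _ K3) as K4.
    pose proof (cont_diff_plus _ _ K2 K4) as K5. pose proof (cont_diff_plus _ _ K1 K5) as K6.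
    assert (HL : cont_diff L) by exact (cont_diff_plus _ _ H3 K6).
    assert (HLY : circle_int L <= circle_int (fun t => Phi (Y t))).
    { apply circle_int_le; [exact (Cc _ HL) | exact (Cc _ (cont_diff_comp _ _ cont_diff_Phi HY)) |].
      intros t. unfold L, Y.
      eapply Rle_trans; [|apply (Phi_taylor (X t) (T t * cos (INR n * t)))].
      - rewrite mult_INR, (Rmult_assoc (INR 2)). change (INR 2) with 2. rewrite cos_2a_cos. right; field.
      - rewrite Rabs_mult. pose proof (Rabs_le _ _ (COS_bound (INR n * t))) as Hb.
        rewrite <- (Rmult_1_r 1). apply Rmult_le_compat; auto using Rabs_pos. }
    unfold L in HLY.
    rewrite (circle_int_plus _ _ (Cc _ H3) (Cc _ K6)), (circle_int_plus _ _ (Cc _ K1) (Cc _ K5)),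
      (circle_int_plus _ _ (Cc _ K2) (Cc _ K4)), (circle_int_scal _ _ (Cc _ H2)), (circle_int_scal _ _ (Cc _ K3)) in HLY.
    apply Rabs_le_between in N1. apply Rabs_le_between in N2. lra.
  - unfold Y. rewrite (circle_int_plus _ _ (Cc _ HX) (Cc _ (Hc (INR n) _ HT))).
    rewrite Rplus_minus_l.
    exact N3.
Qed.

Definition unit_pt (t : R) : C := (cos t, sin t).

Lemma Cmod_unit_pt t : Cmod (unit_pt t) = 1.
Proof.
  unfold Cmod, unit_pt; simpl. replace (_ + _) with ((sin t)² + (cos t)²) by (unfold Rsqr; ring).
  now rewrite sin2_cos2, sqrt_1.
Qed.

Lemma unit_pt_pow t n : (unit_pt t ^ n)%C = unit_pt (INR n * t).
Proof.
  induction n.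
  - simpl. unfold unit_pt. rewrite Rmult_0_l, cos_0, sin_0; easy.
  - rewrite Cpow_S, IHn, S_INR, Rmult_plus_distr_r, Rmult_1_l. unfold unit_pt.
    rewrite Rplus_comm, cos_plus, sin_plus. apply injective_projections; simpl; ring.
Qed.

Definition re_circle (p : cpoly) (t : R) : R := Re (peval p (unit_pt t)).

Lemma cont_diff_re_circle p : cont_diff (re_circle p).
Proof.
  assert (Hcos : forall t, is_derive cos t (- sin t)) by (intros; auto_derive; [easy | ring]).
  assert (Hsin : forall t, is_derive sin t (cos t)) by (intros; auto_derive; [easy | ring]).
  pose proof (fun q t => peval_path_derive q cos sin t _ _ (Hcos t) (Hsin t)) as Hd.
  exists (fun t => Re (peval (pderiv p) (unit_pt t) * ((- sin t)%R, cos t))%C).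
  split; intros t; [apply Hd|].
  destruct (Hd (pderiv p) t) as [H1 H2].
  apply (continuous_ext (fun s => Re (peval (pderiv p) (unit_pt s)) * - sin s - Im (peval (pderiv p) (unit_pt s)) * cos s)).
  { intros s; rewrite re_mult; unfold Re, Im; simpl; ring. }
  assert (K1 : continuous (fun s => Re (peval (pderiv p) (unit_pt s))) t)
    by (apply @ex_derive_continuous; eexists; exact H1).
  assert (K2 : continuous (fun s => Im (peval (pderiv p) (unit_pt s))) t)
    by (apply @ex_derive_continuous; eexists; exact H2).
  assert (K3 : continuous (fun s => - sin s) t) by (apply @ex_derive_continuous; auto_derive; easy).
  assert (K4 : continuous cos t) by (apply @ex_derive_continuous; auto_derive; easy).
  apply @continuous_minus; apply @continuous_mult; assumption.
Qed.


(** * The adapted weight on the circle *)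

Fixpoint reflect_deg (p : cpoly) : nat :=
  match p with
  | Pconst _ => 0
  | Pmonom n => n
  | Padd p q | Pmul p q => reflect_deg p + reflect_deg q
  end.

(** On the unit circle conj z = 1/z, so z^d conj(p(z)) coincides there with a
    polynomial as soon as the power d is large enough; [reflect_deg] is such a d. *)
Fixpoint preflect (p : cpoly) : cpoly :=
  match p with
  | Pconst c => Pconst (Cconj c)
  | Pmonom _ => Pconst 1
  | Padd p q => Padd (Pmul (Pmonom (reflect_deg q)) (preflect p)) (Pmul (Pmonom (reflect_deg p)) (preflect q))
  | Pmul p q => Pmul (preflect p) (preflect q)
  end.

Lemma peval_preflect p z : Cmod z = 1 -> peval (preflect p) z = (z ^ reflect_deg p * Cconj (peval p z))%C.
Proof.
  intros Hz; induction p; cbn [peval preflect reflect_deg].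
  - simpl; ring.
  - rewrite Cpow_conj, <- Cpow_mult_l, <- Cmod2_conj, Hz.
    replace (RtoC (1 ^ 2)) with (RtoC 1) by (f_equal; ring). now rewrite Cpow_1_l.
  - rewrite IHp1, IHp2, Cplus_conj, Cpow_add_r; ring.
  - rewrite IHp1, IHp2, Cmult_conj, Cpow_add_r; ring.
Qed.

Fixpoint ppow (p : cpoly) (n : nat) : cpoly :=
  match n with O => Pconst 1 | S n => Pmul p (ppow p n) end.

Lemma peval_ppow p n z : peval (ppow p n) z = (peval p z ^ n)%C.
Proof. induction n; simpl; [easy|]. now rewrite IHn. Qed.

(** A polynomial substitute for a Gaussian on the range |x| <= sqrt N. *)
Definition bump (N : nat) (x : R) : R := (1 - x ^ 2 / INR N) ^ N.

(** With d = reflect_deg g, the inner expression [re] equals z^d Re(g(z)) on the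
    circle, so the base of the power is z^(2d) (1 - X^2/N). *)
Definition bump_poly (g : cpoly) (N : nat) : cpoly :=
  let re := Pmul (Pconst (RtoC (/ 2))) (Padd (Pmul (Pmonom (reflect_deg g)) g) (preflect g)) in
  ppow (Padd (Pmonom (2 * reflect_deg g)) (Pmul (Pconst (RtoC (- / INR N))) (Pmul re re))) N.

Lemma peval_bump_poly g N z : Cmod z = 1 ->
  peval (bump_poly g N) z = (z ^ (2 * reflect_deg g * N) * RtoC (bump N (Re (peval g z))))%C.
Proof.
  intros Hz. unfold bump_poly. rewrite peval_ppow, Cpow_mult_r. cbn [peval].
  rewrite peval_preflect by exact Hz.
  set (w := (z ^ reflect_deg g)%C).
  replace ((z ^ (2 * reflect_deg g))%C) with (w * w)%C
    by (unfold w; rewrite <- Cpow_add_r; f_equal; lia).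
  unfold bump. rewrite RtoC_pow, <- Cpow_mult_l. f_equal.
  set (v := peval g (z)).
  assert (E : (v + Cconj v)%C = RtoC (2 * Re v)).
  { unfold re_circle. fold v. apply injective_projections; unfold Re; simpl; ring. }
  replace (w * w + RtoC (- / INR N) * (RtoC (/ 2) * (w * v + w * Cconj v) * (RtoC (/ 2) * (w * v + w * Cconj v))))%C
    with (w * w * (1 - RtoC (/ INR N) * (RtoC (/ 2) * (v + Cconj v)) * (RtoC (/ 2) * (v + Cconj v))))%C
    by (rewrite RtoC_opp; ring).
  rewrite E, <- !RtoC_mult, <- RtoC_minus. f_equal. apply (f_equal RtoC). unfold Rdiv. generalize (/ INR N). intros a. field.
Qed.

Lemma exp_pow_nat x n : exp x ^ n = exp (INR n * x).
Proof.
  induction n; [simpl; now rewrite Rmult_0_l, exp_0|].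
  rewrite S_INR, Rmult_plus_distr_r, Rmult_1_l, exp_plus, <- IHn. simpl; ring.
Qed.

Lemma bump_bounds N x : (0 < N)%nat -> 2 * x ^ 2 <= INR N ->
  exp (- 2 * x ^ 2) <= bump N x <= exp (- x ^ 2).
Proof.
  intros HN Hx. assert (HN' : 0 < INR N) by now apply lt_0_INR.
  set (u := x ^ 2 / INR N).
  assert (Hu : u * INR N = x ^ 2) by (unfold u; field; lra).
  assert (H0 : 0 <= u) by (apply Rmult_le_pos; [apply pow2_ge_0 | left; now apply Rinv_0_lt_compat]).
  assert (H1 : u <= / 2) by nra.
  unfold bump; fold u.
  replace (- 2 * x ^ 2) with (INR N * (- 2 * u)) by lra.
  replace (- x ^ 2) with (INR N * (- u)) by lra.
  rewrite <- !exp_pow_nat. split; apply pow_incr; split.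
  - left; apply exp_pos.
  - replace (- 2 * u) with (- (2 * u)) by ring. rewrite exp_Ropp.
    pose proof (exp_ineq1_le (2 * u)). pose proof (exp_pos (2 * u)).
    apply Rmult_le_reg_l with (exp (2 * u)); auto. rewrite Rinv_r by lra. nra.
  - lra.
  - pose proof (exp_ineq1_le (- u)). lra.
Qed.

Lemma exp_le_exp x y : x <= y -> exp x <= exp y.
Proof. intros [H| ->]; [left; now apply exp_increasing | right; easy]. Qed.

(** The weight decays faster than the exponential grows, because x - x^2 <= 1/4. *)
Lemma bump_weight N x : (0 < N)%nat -> 2 * x ^ 2 <= INR N -> bump N x * (1 + exp x) <= 3.
Proof.
  intros HN Hx. destruct (bump_bounds N x HN Hx) as [_ Hb].
  pose proof (exp_pos x).
  apply Rle_trans with (exp (- x ^ 2) * (1 + exp x)); [apply Rmult_le_compat_r; lra|].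
  rewrite Rmult_plus_distr_l, Rmult_1_r, <- exp_plus.
  assert (exp (- x ^ 2) <= exp 0) by (apply exp_le_exp; nra).
  assert (exp (- x ^ 2 + x) <= exp (/ 4)).
  { apply exp_le_exp. assert (0 <= (x - / 2) ^ 2) by apply pow2_ge_0. lra. }
  rewrite exp_0 in *.
  pose proof (exp_ineq1_le (- / 4)) as Hq. rewrite exp_Ropp in Hq.
  pose proof (exp_pos (/ 4)).
  assert (exp (/ 4) <= 2).
  { apply Rmult_le_reg_l with (/ exp (/ 4)); [now apply Rinv_0_lt_compat|].
    rewrite Rinv_l by lra. lra. }
  lra.
Qed.

(** * Powers of the variable *)

(** Since (1 - x) (1 + x + ... + x^n) <= 1 and x^n is the smallest summand. *)
Lemma linear_times_pow n x : 0 <= x <= 1 -> INR (S n) * x ^ n * (1 - x) <= 1.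
Proof.
  intros Hx. enough (INR (S n) * x ^ n * (1 - x) <= 1 - x ^ S n)
    by (pose proof (pow_le_one x (S n) Hx); lra).
  induction n as [|n IH]; [simpl; lra|].
  pose proof (pow_le_one x (S n) Hx) as Hp.
  rewrite S_INR. change (x ^ S (S n)) with (x * x ^ S n).
  change (x ^ S n) with (x * x ^ n) in *.
  set (y := INR (S n)) in *. nra.
Qed.

(** Write r = s^4: three of the factors s^n absorb one factor n each by
    [linear_times_pow], and the fourth one tends to 0. *)
Lemma cubic_times_pow r e : 0 <= r < 1 -> 0 < e ->
  exists n0, forall n, (n0 <= n)%nat -> INR (n + 3) ^ 3 * r ^ n <= e.
Proof.
  intros Hr He.
  set (s := sqrt (sqrt r)).
  assert (Hs0 : 0 <= s) by apply sqrt_pos.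
  assert (Hs4 : s ^ 4 = r).
  { replace (s ^ 4) with ((s * s) * (s * s)) by ring. unfold s.
    rewrite !sqrt_sqrt; auto using sqrt_pos. lra. }
  assert (Hs1 : s < 1).
  { destruct (Rlt_or_le s 1); auto. assert (1 <= s ^ 4) by (apply pow_R1_Rle; auto). lra. }
  set (c := / (1 - s)). assert (Hc : 0 < c) by (apply Rinv_0_lt_compat; lra).
  assert (Hc3 : 0 < 64 * c ^ 3) by (pose proof (pow_lt c 3 Hc); lra).
  assert (He' : 0 < e / (64 * c ^ 3)) by now apply Rdiv_lt_0_compat.
  destruct (pow_lt_1_zero s ltac:(rewrite Rabs_pos_eq; lra) _ He') as [N HN].
  exists (max N 3). intros n Hn.
  specialize (HN n ltac:(lia)).
  assert (Hsn : 0 <= s ^ n) by now apply pow_le.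
  rewrite Rabs_pos_eq in HN by auto.
  assert (Hlin : INR n * s ^ n <= c).
  { pose proof (linear_times_pow n s ltac:(lra)) as H. rewrite S_INR in H.
    apply Rmult_le_reg_r with (1 - s); [lra|]. unfold c. rewrite Rinv_l by lra.
    assert (0 <= s ^ n * (1 - s)) by (apply Rmult_le_pos; lra). lra. }
  assert (Hn3 : INR (n + 3) <= 2 * INR n).
  { rewrite plus_INR. assert (INR 3 <= INR n) by (apply le_INR; lia). lra. }
  pose proof (pos_INR n) as Hpn. pose proof (pos_INR (n + 3)).
  rewrite <- Hs4, <- pow_mult, Nat.mul_comm, pow_mult.
  apply Rle_trans with ((2 * INR n) ^ 3 * (s ^ n) ^ 4).
  { apply Rmult_le_compat_r; [now apply pow_le | apply pow_incr; lra]. }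
  replace ((2 * INR n) ^ 3 * (s ^ n) ^ 4) with (8 * (INR n * s ^ n) ^ 3 * s ^ n) by ring.
  assert (0 <= INR n * s ^ n) by now apply Rmult_le_pos.
  apply Rle_trans with (8 * c ^ 3 * (e / (64 * c ^ 3))).
  - apply Rmult_le_compat; auto.
    + apply Rmult_le_pos; [lra | now apply pow_le].
    + apply Rmult_le_compat_l; [lra|]. apply pow_incr; lra.
    + lra.
  - apply Rle_trans with (e / 8); [right; field; lra | lra].
Qed.

(** Bounds the polynomial and its first three derivatives at once. Three derivatives
    are needed because A contains g'' and has to be differentiable. *)
Definition pbound3 (p : cpoly) : R := pbound p + pbound (pderiv p) + pbound (pderiv (pderiv p)) + pbound (pderiv (pderiv (pderiv p))).

Lemma pbound3_bound p i z : (i <= 3)%nat -> Cmod z <= 1 -> Cmod (peval (pderivn i p) z) <= pbound3 p.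
Proof.
  intros Hi Hz. eapply Rle_trans; [now apply peval_le_pbound|].
  pose proof (pbound_pos p); pose proof (pbound_pos (pderiv p)); pose proof (pbound_pos (pderiv (pderiv p)));
    pose proof (pbound_pos (pderiv (pderiv (pderiv p)))). unfold pbound3.
  destruct i as [|[|[|[|]]]]; simpl; try lra; lia.
Qed.

Lemma pbound3_pos p : 0 <= pbound3 p.
Proof.
  pose proof (pbound_pos p); pose proof (pbound_pos (pderiv p)); pose proof (pbound_pos (pderiv (pderiv p)));
    pose proof (pbound_pos (pderiv (pderiv (pderiv p)))). unfold pbound3; lra.
Qed.

(** The increments are z^m q with m large. Writing m = j + 3 keeps all
    exponents that occur in the first three derivatives free of truncated subtraction. *)
Section ShiftedPolynomial.

Variables (q : cpoly) (j : nat).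
Let m := S (S (S j)).
Let P := Pmul (Pmonom m) q.

Lemma peval_shift1 z :
  peval (pderiv P) z = (RtoC (INR m) * z ^ S (S j) * peval q z + z ^ m * peval (pderiv q) z)%C.
Proof. unfold P, m. cbn [peval pderiv]. ring. Qed.

Lemma peval_shift2 z :
  peval (pderiv (pderiv P)) z =
  (RtoC (INR m * INR (S (S j))) * z ^ S j * peval q z
   + RtoC 2 * (RtoC (INR m) * z ^ S (S j) * peval (pderiv q) z) + z ^ m * peval (pderiv (pderiv q)) z)%C.
Proof. unfold P, m. cbn [peval pderiv]. rewrite RtoC_mult. ring. Qed.

Lemma peval_shift3 z :
  peval (pderiv (pderiv (pderiv P))) z =
  (RtoC (INR m * INR (S (S j)) * INR (S j)) * z ^ j * peval q z
   + RtoC 3 * (RtoC (INR m * INR (S (S j))) * z ^ S j * peval (pderiv q) z)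
   + RtoC 3 * (RtoC (INR m) * z ^ S (S j) * peval (pderiv (pderiv q)) z) + z ^ m * peval (pderiv (pderiv (pderiv q))) z)%C.
Proof. unfold P, m. cbn [peval pderiv]. rewrite !RtoC_mult. ring. Qed.

Lemma shift_small r i z : r <= 1 -> Cmod z <= r -> (i <= 3)%nat ->
  Cmod (peval (pderivn i P) z) <= 8 * (INR (j + 3) ^ 3 * r ^ j) * pbound3 q.
Proof.
  intros Hr Hz Hi.
  pose proof (Cmod_ge_0 z) as Hz0.
  set (M := INR (j + 3)). set (A := r ^ j). set (L := pbound3 q).
  assert (HM : 1 <= M) by (apply (le_INR 1); lia).
  assert (HA : 0 <= A) by (apply pow_le; lra).
  assert (HL : 0 <= L) by apply pbound3_pos.
  assert (Hpow : forall l, (j <= l)%nat -> Cmod (z ^ l) <= A).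
  { intros l Hl. rewrite Cmod_pow. replace l with (j + (l - j))%nat by lia.
    rewrite pow_add. pose proof (pow_le_one (Cmod z) (l - j) ltac:(lra)).
    assert (0 <= Cmod z ^ j) by now apply pow_le.
    assert (Cmod z ^ j <= A) by (apply pow_incr; lra). nra. }
  assert (Hq : forall l, (l <= 3)%nat -> Cmod (peval (pderivn l q) z) <= L) by (intros; apply pbound3_bound; auto; lra).
  assert (Hterm : forall c l k, 0 <= c -> (j <= l)%nat -> (k <= 3)%nat ->
    Cmod (RtoC c * z ^ l * peval (pderivn k q) z) <= c * (A * L)).
  { intros c l k Hc Hl Hk. rewrite !Cmod_mult, Cmod_R, Rabs_pos_eq, Rmult_assoc by auto.
    apply Rmult_le_compat_l; auto. apply Rmult_le_compat; auto using Cmod_ge_0. }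
  assert (Hlast : forall k, (k <= 3)%nat -> Cmod (z ^ m * peval (pderivn k q) z) <= A * L).
  { intros k Hk. rewrite Cmod_mult. apply Rmult_le_compat; auto using Cmod_ge_0. apply Hpow; unfold m; lia. }
  assert (M0 : 0 <= INR m <= M) by (split; [apply pos_INR | apply le_INR; unfold m; lia]).
  assert (M1 : 0 <= INR (S (S j)) <= M) by (split; [apply pos_INR | apply le_INR; lia]).
  assert (M2 : 0 <= INR (S j) <= M) by (split; [apply pos_INR | apply le_INR; lia]).
  assert (MM : 0 <= INR m * INR (S (S j)) <= M * M).
  { split; [apply Rmult_le_pos; lra | apply Rmult_le_compat; lra]. }
  assert (MMM : 0 <= INR m * INR (S (S j)) * INR (S j) <= M * M * M).
  { split; [apply Rmult_le_pos; lra | apply Rmult_le_compat; lra]. }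
  assert (HAL : 0 <= A * L) by now apply Rmult_le_pos.
  assert (E1 : M <= M * M) by nra. assert (E2 : M * M <= M * M * M) by nra.
  assert (Hfin : forall x k, 0 <= k <= 8 * (M * M * M) -> x <= k * (A * L) -> x <= 8 * (M ^ 3 * A) * L).
  { intros x k Hk Hx. eapply Rle_trans; [exact Hx|].
    replace (8 * (M ^ 3 * A) * L) with (8 * (M * M * M) * (A * L)) by ring.
    apply Rmult_le_compat_r; lra. }
  assert (Hconst : forall c v B, 0 <= c -> Cmod v <= B -> Cmod (RtoC c * v) <= c * B).
  { intros c v B Hc Hv. rewrite Cmod_mult, Cmod_R, Rabs_pos_eq by auto. now apply Rmult_le_compat_l. }
  destruct i as [|[|[|[|]]]]; [| | | |lia]; cbn [pderivn].
  - apply (Hfin _ 1); [lra|]. rewrite Rmult_1_l. unfold P; cbn [peval]. apply (Hlast 0%nat); lia.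
  - rewrite peval_shift1. apply (Hfin _ (INR m + 1)); [lra|].
    eapply Rle_trans; [apply Cmod_triangle|].
    pose proof (Hterm (INR m) (S (S j)) 0%nat ltac:(lra) ltac:(lia) ltac:(lia)) as T1.
    pose proof (Hlast 1%nat ltac:(lia)) as T2. cbn [pderivn] in T1, T2. lra.
  - rewrite peval_shift2. apply (Hfin _ (INR m * INR (S (S j)) + 2 * INR m + 1)); [lra|].
    eapply Rle_trans; [apply Cmod_triangle|].
    eapply Rle_trans; [apply Rplus_le_compat_r, Cmod_triangle|].
    pose proof (Hterm (INR m * INR (S (S j))) (S j) 0%nat ltac:(lra) ltac:(lia) ltac:(lia)) as T1.
    pose proof (Hconst 2 _ _ ltac:(lra) (Hterm (INR m) (S (S j)) 1%nat ltac:(lra) ltac:(lia) ltac:(lia))) as T2.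
    pose proof (Hlast 2%nat ltac:(lia)) as T3. cbn [pderivn] in T1, T2, T3. lra.
  - rewrite peval_shift3.
    apply (Hfin _ (INR m * INR (S (S j)) * INR (S j) + 3 * (INR m * INR (S (S j))) + 3 * INR m + 1)); [lra|].
    eapply Rle_trans; [apply Cmod_triangle|].
    eapply Rle_trans; [apply Rplus_le_compat_r, Cmod_triangle|].
    eapply Rle_trans; [apply Rplus_le_compat_r, Rplus_le_compat_r, Cmod_triangle|].
    pose proof (Hterm (INR m * INR (S (S j)) * INR (S j)) j 0%nat ltac:(lra) ltac:(lia) ltac:(lia)) as T1.
    pose proof (Hconst 3 _ _ ltac:(lra) (Hterm (INR m * INR (S (S j))) (S j) 1%nat ltac:(lra) ltac:(lia) ltac:(lia))) as T2.
    pose proof (Hconst 3 _ _ ltac:(lra) (Hterm (INR m) (S (S j)) 2%nat ltac:(lra) ltac:(lia) ltac:(lia))) as T3.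
    pose proof (Hlast 3%nat ltac:(lia)) as T4. cbn [pderivn] in T1, T2, T3, T4. lra.
Qed.

End ShiftedPolynomial.


(** * How an increment changes the growth of the derivatives *)

(** The arguments are the values of g and g' at z for [growth1], and that of g''
    for [growth2]. The summand 1 bounds g' where Re g is negative, and the
    exponential bounds (exp g)'. *)
Definition growth1 (z a b : C) : R := (1 - Cmod z ^ 2) * (Cmod b * (1 + exp (Re a))).
Definition growth2 (z c : C) : R := (1 - Cmod z ^ 2) ^ 2 * Cmod c.

Lemma exp_small x : 0 <= x <= / 2 -> exp x <= 1 + 2 * x.
Proof.
  intros Hx. pose proof (exp_taylor1 x ltac:(rewrite Rabs_pos_eq; lra)) as H.
  apply Rabs_le_between in H. nra.
Qed.

Lemma Re_le_of_close (a b : C) e : Cmod (a - b) <= e -> Re a <= Re b + e.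
Proof.
  intros H. pose proof (re_le_Cmod (a - b)) as K.
  apply Rabs_le_between in K. unfold Re in *; simpl in K. lra.
Qed.

Lemma growth1_perturb z a b a' b' L eta : Cmod z <= 1 -> Cmod a <= L -> Cmod b <= L ->
  0 <= eta <= / 2 -> Cmod (a' - a) <= eta -> Cmod (b' - b) <= eta ->
  growth1 z a' b' <= growth1 z a b + eta * (1 + (2 * L + 2) * exp L).
Proof.
  intros Hz Ha Hb He Ha' Hb'.
  pose proof (Cmod_ge_0 z). pose proof (Cmod_ge_0 b). pose proof (Cmod_ge_0 b').
  set (x := exp (Re a)). assert (Hx0 : 0 < x) by apply exp_pos.
  assert (HxL : x <= exp L).
  { apply exp_le_exp. eapply Rle_trans; [apply Rle_abs|].
    eapply Rle_trans; [apply re_le_Cmod | exact Ha]. }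
  assert (Hx' : exp (Re a') <= x * (1 + 2 * eta)).
  { apply Rle_trans with (x * exp eta).
    - unfold x. rewrite <- exp_plus. apply exp_le_exp. now apply Re_le_of_close.
    - apply Rmult_le_compat_l; [lra | now apply exp_small]. }
  assert (Hb2 : Cmod b' <= Cmod b + eta).
  { replace b' with (b + (b' - b))%C by ring. eapply Rle_trans; [apply Cmod_triangle | lra]. }
  assert (Hmain : Cmod b' * (1 + exp (Re a')) <= Cmod b * (1 + x) + eta * (1 + (2 * L + 2) * exp L)).
  { apply Rle_trans with ((Cmod b + eta) * (1 + x * (1 + 2 * eta))).
    - apply Rmult_le_compat; try lra. pose proof (exp_pos (Re a')); lra.
    - replace ((Cmod b + eta) * (1 + x * (1 + 2 * eta)))
        with (Cmod b * (1 + x) + eta * (1 + x * (2 * Cmod b + 1 + 2 * eta))) by ring.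
      apply Rplus_le_compat_l, Rmult_le_compat_l; [lra|].
      apply Rplus_le_compat_l. rewrite Rmult_comm. apply Rmult_le_compat; lra. }
  assert (0 <= 1 - Cmod z ^ 2 <= 1) by nra.
  assert (0 <= eta * (1 + (2 * L + 2) * exp L)).
  { pose proof (Cmod_ge_0 a). pose proof (exp_pos L). apply Rmult_le_pos; nra. }
  unfold growth1. fold x.
  apply Rle_trans with ((1 - Cmod z ^ 2) * (Cmod b * (1 + x) + eta * (1 + (2 * L + 2) * exp L))).
  - apply Rmult_le_compat_l; lra.
  - rewrite Rmult_plus_distr_l. apply Rplus_le_compat_l. nra.
Qed.

Lemma growth2_perturb z c c' eta : Cmod z <= 1 -> Cmod (c' - c) <= eta ->
  growth2 z c' <= growth2 z c + eta.
Proof.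
  intros Hz Hc. pose proof (Cmod_ge_0 z). pose proof (Cmod_ge_0 (c' - c)).
  assert (Cmod c' <= Cmod c + eta).
  { replace c' with (c + (c' - c))%C by ring. eapply Rle_trans; [apply Cmod_triangle | lra]. }
  assert (0 <= 1 - Cmod z ^ 2 <= 1) by nra.
  assert (0 <= (1 - Cmod z ^ 2) ^ 2 <= 1) by (apply pow_le_one; lra).
  unfold growth2. apply Rle_trans with ((1 - Cmod z ^ 2) ^ 2 * (Cmod c + eta)); nra.
Qed.

(** At distance at most [delta] from the circle, the derivatives that fall on g or q
    are made harmless by the factor [delta]; those that fall on z^m are compensated by
    the powers of 1 - |z|^2, whatever m is, and [Hweight] controls the factor q that
    they leave. *)
Section Outer.

Variables (g q : cpoly) (k : nat) (z : C) (delta L : R).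
Let j := (2 * k + 1)%nat.
Let m := S (S (S j)).
Let G := Padd g (Pmul (Pmonom m) q).
Hypothesis Hz : Cmod z <= 1.
Hypothesis Hdelta : 1 - Cmod z <= delta.
Hypothesis Hdelta_pos : 0 <= delta.
Hypothesis HLg : forall i, (i <= 3)%nat -> Cmod (peval (pderivn i g) z) <= L.
Hypothesis HLq : forall i, (i <= 3)%nat -> Cmod (peval (pderivn i q) z) <= L.
Hypothesis HdL : delta * (L * (1 + exp L)) <= 1.
Hypothesis Hweight : Cmod (peval q z) * (1 + exp (Re (peval g z))) <= 10.

Let rho := Cmod z.

Lemma outer_facts : 0 <= rho <= 1 /\ 0 <= L /\ delta * L <= 1 /\ Cmod (peval q z) <= 10.
Proof.
  assert (0 <= rho <= 1) by (split; [apply Cmod_ge_0 | exact Hz]).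
  assert (HL0 : 0 <= L) by (eapply Rle_trans; [apply Cmod_ge_0 | apply (HLg 0); lia]).
  pose proof (exp_pos L). repeat split; try lra.
  - eapply Rle_trans; [|exact HdL]. apply Rmult_le_compat_l; auto. nra.
  - pose proof (exp_pos (Re (peval g z))). pose proof (Cmod_ge_0 (peval q z)). nra.
Qed.

Lemma one_sub_sq : 0 <= 1 - rho ^ 2 <= 2 * (1 - rho) /\ 1 - rho ^ 2 <= 1.
Proof. destruct outer_facts as [[] _]. split; [split|]; nra. Qed.

Lemma shift_slope : (1 - rho ^ 2) * (INR m * rho ^ S (S j)) <= 2.
Proof.
  destruct outer_facts as [Hr _]. destruct one_sub_sq as [[H1 H2] _].
  pose proof (linear_times_pow (S (S j)) rho Hr) as H. fold m in H.
  assert (0 <= INR m * rho ^ S (S j)) by (apply Rmult_le_pos; [apply pos_INR | apply pow_le; lra]).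
  nra.
Qed.

(** The exponent m = 2 (k + 2) is even, so the left side is at most 16 times the square
    of the quantity of [linear_times_pow] for half the exponent. *)
Lemma shift_curvature : (1 - rho ^ 2) ^ 2 * (INR m * INR (S (S j)) * rho ^ S j) <= 16.
Proof.
  destruct outer_facts as [Hr _]. destruct one_sub_sq as [[H1 H2] _].
  pose proof (linear_times_pow (S k) rho Hr) as H.
  set (y := INR (S (S k)) * rho ^ S k) in *.
  assert (Hy : 0 <= y) by (apply Rmult_le_pos; [apply pos_INR | apply pow_le; lra]).
  assert (Hm : INR m = 2 * INR (S (S k))).
  { rewrite <- (mult_INR 2). f_equal. unfold m, j; lia. }
  assert (Hm1 : INR (S (S j)) <= INR m) by (apply le_INR; unfold m; lia).
  assert (Hp : rho ^ S j = rho ^ S k * rho ^ S k) by (rewrite <- pow_add; f_equal; unfold j; lia).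
  assert (Hb : INR m * INR (S (S j)) * rho ^ S j <= 4 * y ^ 2).
  { rewrite Hp. replace (4 * y ^ 2) with (INR m * INR m * (rho ^ S k * rho ^ S k)) by (rewrite Hm; unfold y; ring).
    apply Rmult_le_compat_r.
    - apply Rmult_le_pos; apply pow_le; lra.
    - apply Rmult_le_compat_l; [apply pos_INR | exact Hm1]. }
  apply Rle_trans with ((1 - rho ^ 2) ^ 2 * (4 * y ^ 2)).
  - apply Rmult_le_compat_l; [apply pow2_ge_0 | exact Hb].
  - replace ((1 - rho ^ 2) ^ 2 * (4 * y ^ 2)) with (4 * ((1 - rho ^ 2) * y) ^ 2) by ring.
    assert (0 <= (1 - rho ^ 2) * y <= 2) by nra. nra.
Qed.

Lemma outer_growth1 : growth1 z (peval G z) (peval (pderiv G) z) <= 24 * exp 10.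
Proof.
  destruct outer_facts as [Hr [HL0 [HdL1 Hq]]]. destruct one_sub_sq as [[H1 H2] _].
  pose proof shift_slope as Hslope.
  set (x := exp (Re (peval g z))) in *. assert (Hx : 0 < x) by apply exp_pos.
  set (S1 := INR m * rho ^ S (S j)) in *.
  assert (HS1 : 0 <= S1) by (apply Rmult_le_pos; [apply pos_INR | apply pow_le; lra]).
  pose proof (pow_le_one rho m Hr) as Hpm.
  assert (Hxe : exp (Re (peval G z)) <= exp 10 * x).
  { unfold x. rewrite <- exp_plus. apply exp_le_exp. rewrite Rplus_comm. apply Re_le_of_close.
    unfold G; cbn [peval]. replace (peval g z + z ^ m * peval q z - peval g z)%C with (z ^ m * peval q z)%C by ring.
    rewrite Cmod_mult, Cmod_pow. fold rho. pose proof (Cmod_ge_0 (peval q z)). nra. }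
  assert (Hd : Cmod (peval (pderiv G) z) <= 2 * L + S1 * Cmod (peval q z)).
  { unfold G; cbn [pderiv peval].
    replace (_ + _)%C with (peval (pderiv g) z + (RtoC (INR m) * z ^ S (S j) * peval q z + z ^ m * peval (pderiv q) z))%C.
    2:{ unfold m, j; cbn [pderiv peval]; ring. }
    eapply Rle_trans; [apply Cmod_triangle|].
    eapply Rle_trans; [apply Rplus_le_compat_l, Cmod_triangle|].
    rewrite !Cmod_mult, !Cmod_pow, Cmod_R, Rabs_pos_eq by apply pos_INR.
    fold rho. fold S1.
    pose proof (HLg 1 ltac:(lia)). pose proof (HLq 1 ltac:(lia)). cbn [pderivn] in *.
    pose proof (Cmod_ge_0 (peval (pderiv q) z)). nra. }
  assert (He10 : 1 <= exp 10) by (rewrite <- exp_0; apply exp_le_exp; lra).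
  assert (HxL : x <= exp L).
  { apply exp_le_exp. eapply Rle_trans; [apply Rle_abs|].
    eapply Rle_trans; [apply re_le_Cmod | apply (HLg 0); lia]. }
  assert (Hb : Cmod (peval (pderiv G) z) * (1 + exp (Re (peval G z)))
               <= exp 10 * (2 * (L * (1 + exp L)) + S1 * 10)).
  { apply Rle_trans with ((2 * L + S1 * Cmod (peval q z)) * (exp 10 * (1 + x))).
    - apply Rmult_le_compat; auto using Cmod_ge_0; [|lra].
      pose proof (exp_pos (Re (peval G z))); lra.
    - replace ((2 * L + S1 * Cmod (peval q z)) * (exp 10 * (1 + x)))
        with (exp 10 * (2 * (L * (1 + x)) + S1 * (Cmod (peval q z) * (1 + x)))) by ring.
      apply Rmult_le_compat_l; [lra|]. apply Rplus_le_compat.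
      + apply Rmult_le_compat_l; [lra|]. apply Rmult_le_compat_l; lra.
      + apply Rmult_le_compat_l; lra. }
  unfold growth1. fold rho.
  eapply Rle_trans; [apply Rmult_le_compat_l; [lra | exact Hb]|].
  replace ((1 - rho ^ 2) * (exp 10 * (2 * (L * (1 + exp L)) + S1 * 10)))
    with (exp 10 * (2 * ((1 - rho ^ 2) * (L * (1 + exp L))) + 10 * ((1 - rho ^ 2) * S1))) by ring.
  assert ((1 - rho ^ 2) * (L * (1 + exp L)) <= 2).
  { pose proof (exp_pos L). assert (0 <= L * (1 + exp L)) by nra.
    apply Rle_trans with (2 * delta * (L * (1 + exp L))); [|lra].
    apply Rmult_le_compat_r; auto. fold rho in Hdelta. lra. }
  rewrite (Rmult_comm 24). apply Rmult_le_compat_l; lra.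
Qed.

Lemma outer_growth2 : growth2 z (peval (pderiv (pderiv G)) z) <= 172.
Proof.
  destruct outer_facts as [Hr [HL0 [HdL1 Hq]]]. destruct one_sub_sq as [[H1 H2] H3].
  pose proof shift_slope as Hslope. pose proof shift_curvature as Hcurv.
  set (S1 := INR m * rho ^ S (S j)) in *.
  set (S2 := INR m * INR (S (S j)) * rho ^ S j) in *.
  assert (HS1 : 0 <= S1) by (apply Rmult_le_pos; [apply pos_INR | apply pow_le; lra]).
  assert (HS2 : 0 <= S2) by (apply Rmult_le_pos; [apply Rmult_le_pos; apply pos_INR | apply pow_le; lra]).
  pose proof (pow_le_one rho m Hr) as Hpm.
  assert (Hd : Cmod (peval (pderiv (pderiv G)) z) <= 2 * L + S2 * 10 + 2 * (S1 * L)).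
  { replace (peval (pderiv (pderiv G)) z) with (peval (pderiv (pderiv g)) z + peval (pderiv (pderiv (Pmul (Pmonom m) q))) z)%C by reflexivity.
    unfold m. rewrite peval_shift2. fold m.
    eapply Rle_trans; [apply Cmod_triangle|].
    eapply Rle_trans; [apply Rplus_le_compat_l, Cmod_triangle|].
    eapply Rle_trans; [apply Rplus_le_compat_l, Rplus_le_compat_r, Cmod_triangle|].
    rewrite !Cmod_mult, !Cmod_pow, !Cmod_R, !Rabs_pos_eq
      by (lra || apply pos_INR || (apply Rmult_le_pos; apply pos_INR)).
    fold rho. fold S1. fold S2.
    pose proof (HLg 2 ltac:(lia)). pose proof (HLq 2 ltac:(lia)). pose proof (HLq 1 ltac:(lia)). cbn [pderivn] in *.
    pose proof (Cmod_ge_0 (peval (pderiv (pderiv q)) z)).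
    assert (S2 * Cmod (peval q z) <= S2 * 10) by (apply Rmult_le_compat_l; lra).
    assert (S1 * Cmod (peval (pderiv q) z) <= S1 * L) by (apply Rmult_le_compat_l; lra).
    assert (rho ^ m * Cmod (peval (pderiv (pderiv q)) z) <= 1 * L) by (apply Rmult_le_compat; lra).
    lra. }
  unfold growth2; fold rho. set (d := 1 - rho ^ 2) in *.
  apply Rle_trans with (d ^ 2 * (2 * L + S2 * 10 + 2 * (S1 * L))).
  - apply Rmult_le_compat_l; [apply pow2_ge_0 | exact Hd].
  - replace (d ^ 2 * (2 * L + S2 * 10 + 2 * (S1 * L)))
      with (2 * (d * (d * L)) + 10 * (d ^ 2 * S2) + 2 * ((d * S1) * (d * L))) by ring.
    assert (HdL2 : 0 <= d * L <= 2).
    { split; [now apply Rmult_le_pos|]. apply Rle_trans with (2 * delta * L); [|lra].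
      apply Rmult_le_compat_r; auto. fold rho in Hdelta; lra. }
    assert (0 <= d * S1) by now apply Rmult_le_pos.
    assert (d * (d * L) <= 1 * 2) by (apply Rmult_le_compat; lra).
    assert (d * S1 * (d * L) <= 2 * 2) by (apply Rmult_le_compat; lra).
    lra.
Qed.

End Outer.


(** * One step of the construction *)

(** A lower bound for curv(X) T^2 that does not depend on N. *)
Definition gain (x : R) : R := curv x * exp (- 2 * x ^ 2) ^ 2.

Lemma continuous_gain x : continuous gain x.
Proof.
  apply @ex_derive_continuous. unfold gain, curv. auto_derive.
  assert (0 < 1 + x * (x * 1)) by nra.
  repeat apply Rmult_integral_contrapositive_currified; lra.
Qed.

Lemma cont_diff_bump N : cont_diff (bump N).
Proof.
  apply (cont_diff_ext (fun x => (1 + (- / INR N) * x ^ 2) ^ N)).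
  { intros x; unfold bump, Rdiv. f_equal. ring. }
  apply cont_diff_pow, cont_diff_plus; [apply cont_diff_const|]. apply cont_diff_mult; [apply cont_diff_const|]. apply cont_diff_pow.
  exists (fun _ => 1); split; intros t; [apply @is_derive_id | apply continuous_const].
Qed.

(** The sum of the two constants obtained in [outer_growth1] and [outer_growth2]. *)
Definition growth_bound : R := 24 * exp 10 + 172.

Definition test_int (g : cpoly) : R := circle_int (fun t => Phi (re_circle g t)).

(** The radius [r] separates the region where the increment is negligible from
    the one where the growth bounds are absolute. On the circle of radius [r] the values of
    [g] are still close to those on the unit circle, so that the means of the limit
    function at radius [r] can be compared with boundary means of [g]. *)
Definition good_step (g : cpoly) (eps : R) (G : cpoly) (r : R) : Prop :=
  (forall i z, (i <= 3)%nat -> Cmod z <= r ->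
     Cmod (peval (pderivn i G) z - peval (pderivn i g) z) <= eps) /\
  (forall z, Cmod z < 1 ->
     growth1 z (peval G z) (peval (pderiv G) z) <= Rmax growth_bound (growth1 z (peval g z) (peval (pderiv g) z) + eps) /\
     growth2 z (peval (pderiv (pderiv G)) z) <= Rmax growth_bound (growth2 z (peval (pderiv (pderiv g)) z) + eps)) /\
  (forall t, Cmod (peval g (r * unit_pt t) - peval g (unit_pt t)) <= 1) /\
  test_int g + / 2 * circle_int (fun t => gain (re_circle g t)) - eps <= test_int G /\
  Rabs (circle_int (re_circle G) - circle_int (re_circle g)) <= eps.

(** On the unit circle itself the product is at most 3; both factors are
    Lipschitz, with constants fixed before [delta] is chosen. *)
Lemma near_circle_weight g q N z delta L :
  (0 < N)%nat -> 2 * pbound g ^ 2 <= INR N -> q = bump_poly g N ->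
  pbound g <= L -> pbound (pderiv g) <= L -> pbound (pderiv q) <= L ->
  0 < Cmod z <= 1 -> 1 - Cmod z <= delta -> 0 <= delta ->
  delta * (L * (1 + 3 * exp L)) <= 1 ->
  Cmod (peval q z) * (1 + exp (Re (peval g z))) <= 10.
Proof.
  intros HN HNg Hq HL0 HL1 HLq Hz Hd Hd0 HdL.
  (* the nearest point of the unit circle *)
  set (w := (z / RtoC (Cmod z))%C).
  assert (Hzn : RtoC (Cmod z) <> RtoC 0) by (intros E; apply RtoC_inj in E; lra).
  assert (Hw : Cmod w = 1).
  { unfold w. rewrite Cmod_div, Cmod_R, Rabs_pos_eq by (auto; lra). field; lra. }
  assert (Hzw : Cmod (z - w) <= delta).
  { replace (z - w)%C with (w * RtoC (Cmod z - 1))%C.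
    - rewrite Cmod_mult, Hw, Cmod_R, Rabs_left1 by lra. lra.
    - rewrite RtoC_minus. unfold w; field; auto. }
  assert (HLpos : 0 <= L) by (eapply Rle_trans; [apply pbound_pos | exact HL0]).
  pose proof (exp_pos L) as HeL.
  assert (HdL1 : L * delta <= 1).
  { rewrite Rmult_comm. eapply Rle_trans; [|exact HdL]. apply Rmult_le_compat_l; auto. nra. }
  assert (Hlip : forall p, pbound (pderiv p) <= L -> Cmod (peval p z - peval p w) <= L * delta).
  { intros p Hp. eapply Rle_trans; [apply peval_lipschitz; lra|].
    apply Rmult_le_compat; auto using pbound_pos, Cmod_ge_0. }
  set (X := Re (peval g w)).
  assert (HX : Rabs X <= pbound g).
  { eapply Rle_trans; [apply re_le_Cmod | apply peval_le_pbound; lra]. }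
  assert (HNX : 2 * X ^ 2 <= INR N).
  { eapply Rle_trans; [|exact HNg]. rewrite <- pow2_abs.
    apply Rmult_le_compat_l; [lra|]. apply pow_incr; split; auto using Rabs_pos. }
  pose proof (bump_weight N X HN HNX) as HT.
  destruct (bump_bounds N X HN HNX) as [HT0 _]. pose proof (exp_pos (- 2 * X ^ 2)).
  set (T := bump N X) in *.
  assert (Hqw : Cmod (peval q w) = T).
  { rewrite Hq, peval_bump_poly by exact Hw. rewrite Cmod_mult, Cmod_pow, Hw, pow1, Cmod_R.
    rewrite Rabs_pos_eq by (fold X; fold T; lra). fold X; fold T; ring. }
  assert (Hqz : Cmod (peval q z) <= T + L * delta).
  { replace (peval q z) with (peval q w + (peval q z - peval q w))%C by ring.
    eapply Rle_trans; [apply Cmod_triangle|]. rewrite Hqw. apply Rplus_le_compat_l; auto. }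
  pose proof (exp_pos X) as HeX.
  assert (HeXL : exp X <= exp L).
  { apply exp_le_exp. eapply Rle_trans; [apply Rle_abs|]. lra. }
  assert (Hgz : exp (Re (peval g z)) <= 3 * exp X).
  { apply Rle_trans with (exp (X + 1)).
    - apply exp_le_exp. apply Re_le_of_close. eapply Rle_trans; [apply Hlip; auto | exact HdL1].
    - rewrite exp_plus, Rmult_comm. apply Rmult_le_compat_r; [lra | apply exp_le_3]. }
  apply Rle_trans with ((T + L * delta) * (1 + 3 * exp X)).
  - apply Rmult_le_compat; auto using Cmod_ge_0; [|lra].
    pose proof (exp_pos (Re (peval g z))); lra.
  - assert (0 <= L * delta) by now apply Rmult_le_pos.
    assert (L * delta * (1 + 3 * exp X) <= L * delta * (1 + 3 * exp L)) by (apply Rmult_le_compat_l; lra).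
    replace (L * delta * (1 + 3 * exp L)) with (delta * (L * (1 + 3 * exp L))) in * by ring.
    rewrite Rmult_plus_distr_r. nra.
Qed.

(** The order of the choices matters: first N and q, which depend on g alone, then the
    distance [delta] to the circle, and only then the exponent m, which makes the
    increment negligible in the smaller disc and its oscillation fast enough. *)
Lemma step g eps r0 : 0 < eps -> r0 < 1 ->
  exists G r, r0 < r < 1 /\ good_step g eps G r.
Proof.
  intros Heps Hr0.
  destruct (INR_unbounded (2 * pbound g ^ 2)) as [N0 HN0].
  set (N := S N0).
  assert (HN : 2 * pbound g ^ 2 <= INR N) by (unfold N; rewrite S_INR; lra).
  assert (HNpos : (0 < N)%nat) by (unfold N; lia).
  set (q := bump_poly g N).
  set (L := pbound3 g + pbound3 q).
  pose proof (pbound3_pos g) as HLg0. pose proof (pbound3_pos q) as HLq0.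
  pose proof (exp_pos L) as HeL.
  assert (HL0 : 0 <= L) by (unfold L; lra).
  assert (HW : 0 <= L * (1 + 3 * exp L)) by nra.
  (* small against the sizes of g and q, which do not depend on m *)
  set (delta := Rmin ((1 - r0) / 2) (Rmin (/ 2) (/ (1 + L * (1 + 3 * exp L))))).
  assert (Hd0 : 0 < delta).
  { repeat apply Rmin_pos; try lra. apply Rinv_0_lt_compat; lra. }
  assert (Hd1 : delta <= (1 - r0) / 2) by apply Rmin_l.
  assert (Hd2 : delta <= / 2) by (eapply Rle_trans; [apply Rmin_r | apply Rmin_l]).
  assert (Hd3 : delta * (L * (1 + 3 * exp L)) <= 1).
  { apply Rle_trans with (/ (1 + L * (1 + 3 * exp L)) * (1 + L * (1 + 3 * exp L))).
    - apply Rmult_le_compat; try lra. eapply Rle_trans; apply Rmin_r.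
    - rewrite Rinv_l; lra. }
  set (r := 1 - delta).
  assert (HcL : 1 <= 1 + (2 * L + 2) * exp L) by nra.
  set (eta := Rmin (Rmin eps (/ 2)) (eps / (1 + (2 * L + 2) * exp L))).
  assert (He0 : 0 < eta).
  { repeat apply Rmin_pos; try lra. apply Rdiv_lt_0_compat; lra. }
  assert (He1 : eta <= eps) by (eapply Rle_trans; apply Rmin_l).
  assert (He2 : eta <= / 2) by (eapply Rle_trans; [apply Rmin_l | apply Rmin_r]).
  assert (He3 : eta * (1 + (2 * L + 2) * exp L) <= eps).
  { apply Rle_trans with (eps / (1 + (2 * L + 2) * exp L) * (1 + (2 * L + 2) * exp L)).
    - apply Rmult_le_compat_r; [lra | apply Rmin_r].
    - right; field; lra. }
  set (X := re_circle g). set (T := fun t => bump N (X t)).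
  assert (HXb : forall t, Rabs (X t) <= pbound g).
  { intros t. eapply Rle_trans; [apply re_le_Cmod | apply peval_le_pbound]. rewrite Cmod_unit_pt; lra. }
  assert (HXN : forall t, 2 * X t ^ 2 <= INR N).
  { intros t. eapply Rle_trans; [|exact HN]. rewrite <- pow2_abs.
    apply Rmult_le_compat_l; [lra|]. apply pow_incr; split; auto using Rabs_pos. }
  assert (HTb : forall t, exp (- 2 * X t ^ 2) <= T t <= 1).
  { intros t. destruct (bump_bounds N (X t) HNpos (HXN t)) as [H1 H2]. split; auto.
    eapply Rle_trans; [exact H2|]. rewrite <- exp_0. apply exp_le_exp.
    pose proof (pow2_ge_0 (X t)); lra. }
  assert (HT1 : forall t, Rabs (T t) <= 1).
  { intros t. pose proof (HTb t). pose proof (exp_pos (- 2 * X t ^ 2)). rewrite Rabs_pos_eq; lra. }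
  assert (HXC : cont_diff X) by apply cont_diff_re_circle.
  assert (HTC : cont_diff T) by exact (cont_diff_comp _ _ (cont_diff_bump N) HXC).
  destruct (cubic_times_pow r (eta / (8 * (pbound3 q + 1)))) as [n0 Hn0].
  { unfold r; lra. }
  { apply Rdiv_lt_0_compat; lra. }
  destruct (oscillation_gain X T eps HXC HTC HT1 Heps) as [n1 Hn1].
  (* m is even, as the estimate of the second derivative near the circle requires *)
  set (k := max n0 n1). set (j := (2 * k + 1)%nat). set (m := S (S (S j))).
  set (P := Pmul (Pmonom m) q). set (G := Padd g P).
  specialize (Hn0 j ltac:(unfold j; lia)).
  set (n := (m + 2 * reflect_deg g * N)%nat).
  specialize (Hn1 n ltac:(unfold n, m, j; lia)). cbn zeta in Hn1.
  assert (HXG : forall t, re_circle G t = X t + T t * cos (INR n * t)).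
  { intros t. unfold re_circle at 1. unfold G, P; cbn [peval].
    unfold q. rewrite peval_bump_poly by apply Cmod_unit_pt.
    rewrite Cmult_assoc, <- Cpow_add_r. fold n. rewrite unit_pt_pow.
    rewrite re_plus, re_scal_r.
    change (Re (unit_pt (INR n * t))) with (cos (INR n * t)).
    change (Re (peval g (unit_pt t))) with (X t). fold (T t). apply f_equal, Rmult_comm. }
  assert (Hclose : forall i z, (i <= 3)%nat -> Cmod z <= r ->
     Cmod (peval (pderivn i G) z - peval (pderivn i g) z) <= eta).
  { intros i z Hi Hz.
    replace (peval (pderivn i G) z - peval (pderivn i g) z)%C with (peval (pderivn i P) z)
      by (destruct i as [|[|[|[|]]]]; try lia; unfold G; cbn [pderivn pderiv peval]; ring).
    eapply Rle_trans; [apply (shift_small q j r i z); auto; unfold r; lra|].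
    apply Rle_trans with (8 * (eta / (8 * (pbound3 q + 1))) * (pbound3 q + 1)); [|right; field; lra].
    apply Rmult_le_compat; try lra.
    apply Rmult_le_pos; [lra|]. apply Rmult_le_pos; [apply pow_le, pos_INR | apply pow_le; unfold r; lra]. }
  assert (He10 : 0 < exp 10) by apply exp_pos.
  assert (HbL : pbound g <= L /\ pbound (pderiv g) <= L /\ pbound (pderiv q) <= L).
  { unfold L, pbound3. pose proof (pbound_pos g); pose proof (pbound_pos (pderiv g)); pose proof (pbound_pos (pderiv (pderiv g)));
      pose proof (pbound_pos (pderiv (pderiv (pderiv g)))); pose proof (pbound_pos q); pose proof (pbound_pos (pderiv q));
      pose proof (pbound_pos (pderiv (pderiv q))); pose proof (pbound_pos (pderiv (pderiv (pderiv q)))). repeat split; lra. }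
  destruct HbL as [Hbg [Hbg' Hbq']].
  assert (HLg : forall i z, (i <= 3)%nat -> Cmod z <= 1 -> Cmod (peval (pderivn i g) z) <= L).
  { intros i z Hi Hz. eapply Rle_trans; [now apply pbound3_bound | unfold L; lra]. }
  assert (HLq : forall i z, (i <= 3)%nat -> Cmod z <= 1 -> Cmod (peval (pderivn i q) z) <= L).
  { intros i z Hi Hz. eapply Rle_trans; [now apply pbound3_bound | unfold L; lra]. }
  assert (Hd4 : delta * (L * (1 + exp L)) <= 1).
  { eapply Rle_trans; [|exact Hd3]. apply Rmult_le_compat_l; [lra|]. apply Rmult_le_compat_l; lra. }
  assert (Hnear : forall z, r < Cmod z < 1 -> Cmod (peval q z) * (1 + exp (Re (peval g z))) <= 10).
  { intros z Hz. unfold r in Hz.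
    apply (near_circle_weight g q N z delta L); auto; lra. }
  exists G, r. split; [unfold r; lra|].
  split; [|split; [|split; [|split]]].
  - intros i z Hi Hz. eapply Rle_trans; [now apply Hclose | exact He1].
  - intros z Hz1. destruct (Rle_or_lt (Cmod z) r) as [Hzr|Hzr].
    + split; (eapply Rle_trans; [|apply Rmax_r]).
      * eapply Rle_trans; [apply (growth1_perturb z (peval g z) (peval (pderiv g) z) _ _ L eta)|]; try lra.
        -- apply (HLg 0%nat); lia || lra.
        -- apply (HLg 1%nat); lia || lra.
        -- apply (Hclose 0%nat); auto; lia.
        -- apply (Hclose 1%nat); auto; lia.
      * eapply Rle_trans; [apply (growth2_perturb z (peval (pderiv (pderiv g)) z) _ eta)|]; try lra.
        apply (Hclose 2%nat); auto; lia.
    + assert (Hzd : 1 - Cmod z <= delta) by (unfold r in Hzr; lra).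
      assert (Hz : Cmod z <= 1) by lra.
      specialize (Hnear z ltac:(lra)).
      split; (eapply Rle_trans; [|apply Rmax_l]).
      * apply Rle_trans with (24 * exp 10); [|unfold growth_bound; lra].
        apply (outer_growth1 g q k z delta L); auto; lra.
      * apply Rle_trans with 172; [|unfold growth_bound; lra].
        apply (outer_growth2 g q k z delta L); auto; lra.
  - intros t.
    assert (Hr : Cmod (RtoC r * unit_pt t) = r).
    { rewrite Cmod_mult, Cmod_unit_pt, Cmod_R, Rabs_pos_eq; unfold r; lra. }
    eapply Rle_trans; [apply peval_lipschitz; [rewrite Hr; unfold r; lra | rewrite Cmod_unit_pt; lra]|].
    replace (RtoC r * unit_pt t - unit_pt t)%C with (RtoC (- delta) * unit_pt t)%C
      by (unfold r; rewrite RtoC_minus, RtoC_opp; ring).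
    rewrite Cmod_mult, Cmod_unit_pt, Cmod_R, Rabs_Ropp, Rabs_pos_eq, Rmult_1_r by lra.
    eapply Rle_trans; [|exact Hd3]. rewrite Rmult_comm. apply Rmult_le_compat_l; [lra|]. nra.
  - destruct Hn1 as [Hgain _]. unfold test_int.
    rewrite (circle_int_ext (fun t => Phi (re_circle G t)) (fun t => Phi (X t + T t * cos (INR n * t))))
      by (intros t; now rewrite HXG).
    eapply Rle_trans; [|exact Hgain]. fold X.
    apply Rplus_le_compat_r, Rplus_le_compat_l, Rmult_le_compat_l; [lra|].
    apply circle_int_le.
    + intros t. apply (continuous_comp X gain); [now apply cont_diff_continuous | apply continuous_gain].
    + intros t. apply cont_diff_continuous. exact (cont_diff_mult _ _ (cont_diff_comp _ _ cont_diff_curv HXC) (cont_diff_pow _ 2 HTC)).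
    + intros t. unfold gain. apply Rmult_le_compat_l.
      * left. unfold curv. apply Rinv_0_lt_compat. pose proof (pow2_ge_0 (X t)). nra.
      * apply pow_incr. split; [left; apply exp_pos | apply HTb].
  - destruct Hn1 as [_ Hmean]. fold X.
    now rewrite (circle_int_ext (re_circle G) (fun t => X t + T t * cos (INR n * t))).
Qed.


(** * The limit function *)

Definition good_sequence (p : nat -> cpoly) (r : nat -> R) : Prop :=
  p 0%nat = Pconst 0 /\
  (forall j, r j <= r (S j)) /\
  (forall j, 1 - / INR (S j) < r j < 1) /\
  (forall j, good_step (p j) ((/ 2) ^ j) (p (S j)) (r j)).

Lemma good_sequence_exists : exists p r, good_sequence p r.
Proof.
  assert (Hr : forall (s : {x : R | x < 1}) j, Rmax (proj1_sig s) (1 - / INR (S j)) < 1).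
  { intros [x Hx] j; simpl. apply Rmax_lub_lt; auto.
    pose proof (Rinv_0_lt_compat _ (lt_0_INR (S j) ltac:(lia))). simpl in *; lra. }
  set (next := fun (st : cpoly * {x : R | x < 1}) (j : nat) (st' : cpoly * {x : R | x < 1}) =>
    Rmax (proj1_sig (snd st)) (1 - / INR (S j)) < proj1_sig (snd st') /\
    good_step (fst st) ((/ 2) ^ j) (fst st') (proj1_sig (snd st'))).
  assert (Hnext : forall st j, {st' | next st j st'}).
  { intros st j. apply constructive_indefinite_description.
    destruct (step (fst st) ((/ 2) ^ j) _ (half_pow_pos j) (Hr (snd st) j)) as [G [r [[H1 H2] H3]]].
    exists (G, exist _ r H2). split; auto. }
  set (s := fix s (j : nat) : cpoly * {x : R | x < 1} :=
    match j with
    | O => (Pconst 0, exist _ 0 Rlt_0_1)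
    | S j => proj1_sig (Hnext (s j) j)
    end).
  assert (Hs : forall j, next (s j) j (s (S j))) by (intros j; apply (proj2_sig (Hnext (s j) j))).
  exists (fun j => fst (s j)), (fun j => proj1_sig (snd (s (S j)))).
  split; [reflexivity | split; [|split]].
  - intros j. destruct (Hs (S j)) as [H _]. left. eapply Rle_lt_trans; [apply Rmax_l | exact H].
  - intros j. split; [|exact (proj2_sig (snd (s (S j))))].
    destruct (Hs j) as [H _]. eapply Rle_lt_trans; [apply Rmax_r | exact H].
  - intros j. apply (Hs j).
Qed.

(** Where Phi x > M the left side is negative; elsewhere |x| <= M, and [gain]
    decreases in |x|. Replacing [gain] by a multiple of 1 - Phi / M is a form of Markov's
    inequality that avoids measuring sets. *)
Lemma gain_lower M x : 0 < M -> gain M * (1 - Phi x / M) <= gain x.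
Proof.
  intros HM.
  assert (HK : forall y, 0 < gain y).
  { intros y. unfold gain, curv. apply Rmult_lt_0_compat.
    - apply Rinv_0_lt_compat. pose proof (pow2_ge_0 y). nra.
    - apply pow_lt, exp_pos. }
  destruct (Rle_or_lt (Phi x) M) as [H|H].
  - assert (Hx : x ^ 2 <= M ^ 2).
    { rewrite <- (pow2_abs x). apply pow_incr; split; [apply Rabs_pos|].
      eapply Rle_trans; [apply Rabs_le_Phi | exact H]. }
    assert (Hm : gain M <= gain x).
    { pose proof (pow2_ge_0 x).
      unfold gain, curv. apply Rmult_le_compat.
      - left; apply Rinv_0_lt_compat; nra.
      - left; apply pow_lt, exp_pos.
      - apply Rinv_le_contravar; [nra|]. apply Rmult_le_compat_l; [lra|]. apply pow_incr; lra.
      - apply pow_incr; split; [left; apply exp_pos|]. apply exp_le_exp. lra. }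
    assert (0 <= Phi x / M) by (apply Rdiv_le_0_compat; auto; pose proof (Phi_ge_1 x); lra).
    pose proof (HK M). nra.
  - assert (1 < Phi x / M).
    { apply Rmult_lt_reg_r with M; auto. unfold Rdiv. rewrite Rmult_assoc, Rinv_l by lra. lra. }
    pose proof (HK M). pose proof (HK x). nra.
Qed.

Lemma lipschitz_of_derive u u' a b : (forall t, is_derive u t (u' t)) -> (forall t, Rabs (u' t) <= 1) ->
  Rabs (u b - u a) <= Rabs (b - a).
Proof.
  intros Hu Hu'. destruct (MVT_gen u a b u') as [c [_ Hc]].
  - intros; apply Hu.
  - intros t _. apply derivable_continuous_pt. exists (u' t). now apply is_derive_Reals.
  - rewrite Hc, Rabs_mult. specialize (Hu' c). pose proof (Rabs_pos (b - a)). nra.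
Qed.

Lemma unit_pt_lipschitz s t : Cmod (unit_pt s - unit_pt t) <= 2 * Rabs (s - t).
Proof.
  eapply Rle_trans; [apply Cmod_le_abs|]. unfold unit_pt; simpl.
  assert (H1 : Rabs (cos s - cos t) <= Rabs (s - t)).
  { apply (lipschitz_of_derive cos (fun x => - sin x)).
    - intros; auto_derive; [easy | ring].
    - intros; rewrite Rabs_Ropp; apply Rabs_le, SIN_bound. }
  assert (H2 : Rabs (sin s - sin t) <= Rabs (s - t)).
  { apply (lipschitz_of_derive sin cos).
    - intros; auto_derive; [easy | ring].
    - intros; apply Rabs_le, COS_bound. }
  unfold Rminus in *; lra.
Qed.

Lemma sup_disc_le (g : C -> R) M : (forall z, unit_disc z -> g z <= M) -> Rbar_le (sup_disc g) M.
Proof.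
  intros H. unfold sup_disc. apply (proj2 (Lub_Rbar_correct _)).
  intros y [z [Hz ->]]. now apply H.
Qed.

Section Limit.

Variables (p : nat -> cpoly) (r : nat -> R).
Hypothesis Hp : good_sequence p r.

Lemma gs_close j i z : (i <= 3)%nat -> Cmod z <= r j ->
  Cmod (peval (pderivn i (p (S j))) z - peval (pderivn i (p j)) z) <= (/ 2) ^ j.
Proof. intros Hi Hz. destruct Hp as [_ [_ [_ H]]]. now apply H. Qed.

Lemma gs_r_lim rho : rho < 1 -> exists J, forall j, (J <= j)%nat -> rho < r j.
Proof.
  intros Hrho. destruct (INR_unbounded (/ (1 - rho))) as [J HJ].
  exists J; intros j Hj. destruct Hp as [_ [_ [H _]]]. destruct (H j) as [H1 _].
  assert (HJj : INR J <= INR (S j)) by (apply le_INR; lia).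
  assert (Hpos : 0 < / (1 - rho)) by (apply Rinv_0_lt_compat; lra).
  assert (/ INR (S j) < 1 - rho); [|lra].
  rewrite <- (Rinv_inv (1 - rho)). apply Rinv_lt_contravar; [|lra].
  apply Rmult_lt_0_compat; lra.
Qed.

Lemma gs_growth_bound j z : Cmod z < 1 ->
  growth1 z (peval (p j) z) (peval (pderiv (p j)) z) <= growth_bound + 2 - 2 * (/ 2) ^ j /\
  growth2 z (peval (pderiv (pderiv (p j))) z) <= growth_bound + 2 - 2 * (/ 2) ^ j.
Proof.
  intros Hz. assert (HB : 0 < growth_bound) by (unfold growth_bound; pose proof (exp_pos 10); lra).
  destruct Hp as [H0 [_ [_ H]]].
  induction j as [|j [IH1 IH2]].
  - rewrite H0. unfold growth1, growth2; cbn [pderiv peval]. rewrite Cmod_0. simpl; lra.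
  - destruct (H j) as [_ [HQ _]]. destruct (HQ z Hz) as [HQ1 HQ2].
    pose proof (half_pow_pos j).
    assert ((/ 2) ^ j <= 1) by (apply pow_le_one; lra).
    split; (eapply Rle_trans; [eassumption|]); apply Rmax_lub; simpl; lra.
Qed.

Lemma gs_mean j : Rabs (circle_int (re_circle (p j))) <= 2.
Proof.
  destruct Hp as [H0 [_ [_ H]]].
  enough (Rabs (circle_int (re_circle (p j))) <= 2 - 2 * (/ 2) ^ j) by (pose proof (half_pow_pos j); lra).
  induction j as [|j IH].
  - rewrite H0, (circle_int_ext _ (fun _ => 0)) by reflexivity.
    rewrite circle_int_const, Rmult_0_r, Rabs_R0. simpl; lra.
  - destruct (H j) as [_ [_ [_ [_ Hm]]]].
    replace (circle_int (re_circle (p (S j))))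
      with ((circle_int (re_circle (p (S j))) - circle_int (re_circle (p j))) + circle_int (re_circle (p j))) by ring.
    eapply Rle_trans; [apply Rabs_triang|]. simpl; lra.
Qed.

(** If the integrals of Phi(X) stayed below M, [gain_lower] at the level
    M / PI would make each step increase them by a fixed amount. The errors of the
    steps are summable. *)
Lemma gs_test_int_unbounded M J : exists j, (J <= j)%nat /\ M <= test_int (p j).
Proof.
  apply NNPP; intros Hno.
  assert (Hb : forall j, (J <= j)%nat -> test_int (p j) < M).
  { intros j Hj. apply Rnot_le_lt; intros Hle. apply Hno. now exists j. }
  pose proof PI_RGT_0 as Hpi.
  assert (Harea0 : forall j, 0 <= test_int (p j)).
  { intros j. unfold test_int. rewrite <- (Rmult_0_r (2 * PI)), <- circle_int_const.
    apply circle_int_le; [intros; apply continuous_const | |].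
    - intros t; apply cont_diff_continuous.
      exact (cont_diff_comp _ _ cont_diff_Phi (cont_diff_re_circle (p j))).
    - intros t; pose proof (Phi_ge_1 (re_circle (p j) t)); lra. }
  assert (HM : 0 < M) by (pose proof (Hb J (le_n J)); pose proof (Harea0 J); lra).
  (* the level at which the linear bound of [gain_lower] keeps half of the total mass 2 PI *)
  set (M' := M / PI). assert (HM' : 0 < M') by now apply Rdiv_lt_0_compat.
  set (c := gain M'). assert (Hc : 0 < c).
  { unfold c, gain, curv. apply Rmult_lt_0_compat; [|apply pow_lt, exp_pos].
    apply Rinv_0_lt_compat. pose proof (pow2_ge_0 M'). nra. }
  assert (Hstep : forall j, (J <= j)%nat -> test_int (p j) + c * PI / 2 - (/ 2) ^ j <= test_int (p (S j))).
  { intros j Hj. destruct Hp as [_ [_ [_ H]]]. destruct (H j) as [_ [_ [_ [Hg _]]]].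
    assert (HX : forall t, continuous (fun t => Phi (re_circle (p j) t)) t).
    { intros t; apply cont_diff_continuous.
      exact (cont_diff_comp _ _ cont_diff_Phi (cont_diff_re_circle (p j))). }
    assert (Hk : c * PI <= circle_int (fun t => gain (re_circle (p j) t))).
    { apply Rle_trans with (circle_int (fun t => c + (- (c / M')) * Phi (re_circle (p j) t))).
      - rewrite circle_int_plus, circle_int_scal, circle_int_const; auto.
        2:{ intros; apply continuous_const. }
        2:{ intros; apply @continuous_mult; auto using continuous_const. }
        fold (test_int (p j)).
        assert (c / M' * test_int (p j) <= c / M' * M).
        { apply Rmult_le_compat_l; [left; now apply Rdiv_lt_0_compat | left; auto]. }
        replace (c / M' * M) with (c * PI) in * by (unfold M'; field; lra).
        lra.
      - apply circle_int_le.
        + intros t; apply @continuous_plus; [apply continuous_const|].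
          apply @continuous_mult; auto using continuous_const.
        + intros t. apply (continuous_comp (re_circle (p j)) gain); [|apply continuous_gain].
          apply cont_diff_continuous, cont_diff_re_circle.
        + intros t. eapply Rle_trans; [|apply (gain_lower M'); auto]. fold c.
          right; field; lra. }
    lra. }
  assert (Hgrow : forall n, INR n * (c * PI / 2) - 2 + 2 * (/ 2) ^ (J + n) <= test_int (p (J + n)%nat)).
  { induction n as [|n IH].
    - rewrite Nat.add_0_r. pose proof (Harea0 J).
      assert ((/ 2) ^ J <= 1) by (apply pow_le_one; lra). simpl; lra.
    - rewrite Nat.add_succ_r, S_INR. specialize (Hstep (J + n)%nat ltac:(lia)). simpl pow. lra. }
  assert (HcPI : 0 < c * PI / 2) by nra.
  destruct (INR_unbounded ((M + 2) / (c * PI / 2))) as [n Hn].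
  specialize (Hgrow n). specialize (Hb (J + n)%nat ltac:(lia)).
  pose proof (half_pow_pos (J + n)).
  assert (M + 2 < INR n * (c * PI / 2)).
  { apply Rmult_lt_compat_r with (r := c * PI / 2) in Hn; auto.
    replace ((M + 2) / (c * PI / 2) * (c * PI / 2)) with (M + 2) in Hn by (field; split; lra). lra. }
  lra.
Qed.

Definition glim (i : nat) : C -> C := plim p i.

Lemma gs_r_lim1 rho : rho < 1 -> exists j, rho < r j.
Proof. intros H; destruct (gs_r_lim rho H) as [J HJ]; exists J; auto. Qed.

Lemma glim_cderiv i z : (i <= 2)%nat -> Cmod z < 1 -> cderiv (glim i) z (glim (S i) z).
Proof.
  intros Hi Hz. destruct Hp as [_ [Hr _]].
  apply (plim_cderiv p r 3); auto using gs_r_lim1; try lia.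
  intros; now apply gs_close.
Qed.

Lemma glim_approx i z eps : (i <= 3)%nat -> Cmod z < 1 -> 0 < eps ->
  exists N, forall n, (N <= n)%nat -> Cmod (glim i z - peval (pderivn i (p n)) z) < eps.
Proof.
  intros Hi Hz. destruct Hp as [_ [Hr _]].
  apply (plim_approx p r 3); auto using gs_r_lim1.
  intros; now apply gs_close.
Qed.

Lemma glim_close j z : Cmod z <= r j -> Cmod (glim 0 z - peval (p j) z) <= 2.
Proof.
  intros Hz. destruct Hp as [_ [Hr _]].
  eapply Rle_trans; [apply (plim_bound p r 3 Hr (fun j i z => gs_close j i z) 0 z j); auto; lia|].
  assert ((/ 2) ^ j <= 1) by (apply pow_le_one; lra). lra.
Qed.

Lemma glim_growth1 z : Cmod z < 1 -> growth1 z (glim 0 z) (glim 1 z) <= growth_bound + 2.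
Proof.
  intros Hz. apply le_epsilon; intros e He.
  set (L := Cmod (glim 0 z) + Cmod (glim 1 z) + 1).
  pose proof (Cmod_ge_0 (glim 0 z)); pose proof (Cmod_ge_0 (glim 1 z)).
  assert (HL : 1 <= L) by (unfold L; lra). pose proof (exp_pos L).
  set (K := 1 + (2 * L + 2) * exp L). assert (HK : 0 < K) by (unfold K; nra).
  (* small enough for the error term of [growth1_perturb] to be at most e *)
  set (eta := Rmin (/ 2) (e / K)).
  assert (He0 : 0 < eta) by (apply Rmin_pos; [lra | now apply Rdiv_lt_0_compat]).
  assert (He1 : eta <= / 2) by apply Rmin_l.
  assert (He2 : eta * K <= e).
  { apply Rle_trans with (e / K * K); [apply Rmult_le_compat_r; [lra | apply Rmin_r] | right; field; lra]. }
  destruct (glim_approx 0 z eta) as [N0 HN0]; [lia|auto|auto|].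
  destruct (glim_approx 1 z eta) as [N1 HN1]; [lia|auto|auto|].
  set (n := max N0 N1).
  specialize (HN0 n ltac:(lia)). specialize (HN1 n ltac:(lia)). cbn [pderivn] in HN0, HN1.
  assert (Hsmall : forall a b : C, Cmod (a - b) < eta -> Cmod b <= Cmod a + 1).
  { intros a b Hab. replace b with (a + - (a - b))%C by ring.
    eapply Rle_trans; [apply Cmod_triangle|]. rewrite Cmod_opp. lra. }
  destruct (gs_growth_bound n z Hz) as [HQ _]. pose proof (half_pow_pos n).
  eapply Rle_trans; [apply (growth1_perturb z (peval (p n) z) (peval (pderiv (p n)) z) _ _ L eta)|]; try lra.
  - apply Hsmall in HN0. unfold L; lra.
  - apply Hsmall in HN1. unfold L; lra.
  - fold K; lra.
Qed.

Lemma glim_growth2 z : Cmod z < 1 -> growth2 z (glim 2 z) <= growth_bound + 2.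
Proof.
  intros Hz. apply le_epsilon; intros e He.
  destruct (glim_approx 2 z e) as [n Hn]; [lia|auto|auto|].
  specialize (Hn n (le_n n)). cbn [pderivn] in Hn.
  destruct (gs_growth_bound n z Hz) as [_ HQ]. pose proof (half_pow_pos n).
  eapply Rle_trans; [apply (growth2_perturb z (peval (pderiv (pderiv (p n))) z) _ e)|]; lra.
Qed.

Lemma glim_circle_continuous rho t : 0 <= rho < 1 ->
  continuous (fun s => Re (glim 0 (RtoC rho * unit_pt s))) t.
Proof.
  intros Hrho.
  assert (Hz : Cmod (RtoC rho * unit_pt t) < 1).
  { rewrite Cmod_mult, Cmod_unit_pt, Cmod_R, Rabs_pos_eq; lra. }
  destruct (cderiv_local_lipschitz _ _ _ (glim_cderiv 0 _ ltac:(lia) Hz)) as [L [d [HL [Hd HLd]]]].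
  apply continuity_pt_filterlim. intros e He.
  exists (Rmin (d / 2) (e / (2 * L))). split.
  { apply Rmin_pos; [lra | apply Rdiv_lt_0_compat; lra]. }
  intros s [_ Hs]. change (Rabs (s - t) < Rmin (d / 2) (e / (2 * L))) in Hs.
  change (Rabs (Re (glim 0 (RtoC rho * unit_pt s)) - Re (glim 0 (RtoC rho * unit_pt t))) < e).
  assert (H1 : Rabs (s - t) < d / 2) by (eapply Rlt_le_trans; [exact Hs | apply Rmin_l]).
  assert (H2 : Rabs (s - t) < e / (2 * L)) by (eapply Rlt_le_trans; [exact Hs | apply Rmin_r]).
  assert (H3 : Cmod (RtoC rho * unit_pt s - RtoC rho * unit_pt t) <= 2 * Rabs (s - t)).
  { replace (RtoC rho * unit_pt s - RtoC rho * unit_pt t)%C with (RtoC rho * (unit_pt s - unit_pt t))%C by ring.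
    rewrite Cmod_mult, Cmod_R, Rabs_pos_eq by lra.
    pose proof (unit_pt_lipschitz s t). pose proof (Cmod_ge_0 (unit_pt s - unit_pt t)). nra. }
  specialize (HLd (RtoC rho * unit_pt s)%C ltac:(lra)).
  apply Rle_lt_trans with (Cmod (glim 0 (RtoC rho * unit_pt s) - glim 0 (RtoC rho * unit_pt t))).
  { replace (Re (glim 0 (RtoC rho * unit_pt s)) - Re (glim 0 (RtoC rho * unit_pt t)))
      with (Re (glim 0 (RtoC rho * unit_pt s) - glim 0 (RtoC rho * unit_pt t))%C) by (unfold Cminus; rewrite re_plus, re_opp; ring).
    apply re_le_Cmod. }
  eapply Rle_lt_trans; [exact HLd|].
  apply Rle_lt_trans with (L * (2 * Rabs (s - t))); [apply Rmult_le_compat_l; lra|].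
  apply Rlt_le_trans with (L * (2 * (e / (2 * L)))); [|right; field; lra].
  apply Rmult_lt_compat_l; lra.
Qed.

(** * The solution and its coefficient *)

Section Solution.

Variable e : R.
Hypothesis He : 0 < e <= 1.

Definition sol (z : C) : C := Cexp (RtoC e * glim 0 z).
Definition coef (z : C) : C := (- (RtoC e * glim 2 z + RtoC e * glim 1 z * (RtoC e * glim 1 z)))%C.

Lemma sol_cderiv z : Cmod z < 1 -> cderiv sol z (RtoC e * glim 1 z * sol z)%C.
Proof.
  intros Hz. apply (cderiv_Cexp_comp (fun w => RtoC e * glim 0 w)%C), cderiv_scal, glim_cderiv; auto.
Qed.

Lemma sol_C_derive z : Cmod z < 1 -> C_derive sol z = (RtoC e * glim 1 z * sol z)%C.
Proof. intros Hz; now apply cderiv_C_derive, sol_cderiv. Qed.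

Lemma sol_cderiv2 z : Cmod z < 1 -> cderiv (C_derive sol) z (- coef z * sol z)%C.
Proof.
  intros Hz.
  apply (cderiv_ext_loc (fun w => RtoC e * glim 1 w * sol w)%C _ _ _ (1 - Cmod z)); [lra| |].
  - intros w Hw. apply sol_C_derive. replace w with ((w - z) + z)%C by ring.
    eapply Rle_lt_trans; [apply Cmod_triangle | lra].
  - eapply cderiv_eq; [|apply cderiv_mult; [apply cderiv_scal, (glim_cderiv 1); auto | now apply sol_cderiv]].
    cbn beta; unfold coef; ring.
Qed.

Lemma coef_analytic : analytic_in_disc coef.
Proof.
  intros z Hz. eexists. apply cderiv_is_derive.
  apply (cderiv_ext_loc (fun w => RtoC (-1) * (RtoC e * glim 2 w + RtoC e * glim 1 w * (RtoC e * glim 1 w)))%C _ _ _ 1); [lra| |].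
  - intros w _. unfold coef. ring.
  - apply cderiv_mult; [apply cderiv_const|]. apply cderiv_plus.
    + apply cderiv_scal, (glim_cderiv 2); auto.
    + apply cderiv_mult; apply cderiv_scal, (glim_cderiv 1); auto.
Qed.

Lemma sol_analytic : analytic_in_disc sol.
Proof. intros z Hz. eexists. now apply cderiv_is_derive, sol_cderiv. Qed.

Lemma sol_solves : solves_ode coef sol.
Proof.
  intros z Hz. rewrite (cderiv_C_derive _ _ _ (sol_cderiv2 z Hz)).
  change (- coef z * sol z + coef z * sol z = 0)%C. ring.
Qed.

Lemma sol_zero_free : zero_free sol.
Proof.
  intros z _ H. pose proof (Cmod_Cexp (RtoC e * glim 0 z)) as K. fold (sol z) in K.
  rewrite H, Cmod_0 in K. pose proof (exp_pos (fst (RtoC e * glim 0 z)%C)). lra.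
Qed.

Lemma glim1_bound z : Cmod z < 1 -> (1 - Cmod z ^ 2) * Cmod (glim 1 z) <= growth_bound + 2.
Proof.
  intros Hz. eapply Rle_trans; [|apply (glim_growth1 z Hz)]. unfold growth1.
  pose proof (Cmod_ge_0 z). pose proof (Cmod_ge_0 (glim 1 z)). pose proof (exp_pos (Re (glim 0 z))).
  apply Rmult_le_compat_l; nra.
Qed.

Lemma coef_L0 : Rbar_le (L0_norm coef) (e * ((growth_bound + 2) + (growth_bound + 2) ^ 2)).
Proof.
  apply sup_disc_le. intros z Hz. unfold unit_disc in Hz.
  pose proof (glim1_bound z Hz) as H1. pose proof (glim_growth2 z Hz) as H2. unfold growth2 in H2.
  pose proof (Cmod_ge_0 z).
  set (d := 1 - Cmod z ^ 2) in *. assert (Hd : 0 <= d) by (unfold d; nra).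
  assert (HA : Cmod (coef z) <= e * Cmod (glim 2 z) + e * e * Cmod (glim 1 z) ^ 2).
  { unfold coef. rewrite Cmod_opp. eapply Rle_trans; [apply Cmod_triangle|].
    rewrite !Cmod_mult, Cmod_R, Rabs_pos_eq by lra. right; ring. }
  pose proof (Cmod_ge_0 (glim 1 z)). assert (0 <= d * Cmod (glim 1 z)) by now apply Rmult_le_pos.
  assert (Hsq : (d * Cmod (glim 1 z)) ^ 2 <= (growth_bound + 2) ^ 2) by (apply pow_incr; lra).
  apply Rle_trans with ((e * Cmod (glim 2 z) + e * e * Cmod (glim 1 z) ^ 2) * d ^ 2).
  - apply Rmult_le_compat_r; [apply pow2_ge_0 | exact HA].
  - replace ((e * Cmod (glim 2 z) + e * e * Cmod (glim 1 z) ^ 2) * d ^ 2)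
      with (e * (d ^ 2 * Cmod (glim 2 z)) + e * (e * (d * Cmod (glim 1 z)) ^ 2)) by ring.
    rewrite Rmult_plus_distr_l. apply Rplus_le_compat; apply Rmult_le_compat_l; try lra.
    pose proof (pow2_ge_0 (d * Cmod (glim 1 z))). nra.
Qed.

Lemma sol_Cmod z : Cmod (sol z) = exp (e * Re (glim 0 z)).
Proof.
  unfold sol. rewrite Cmod_Cexp. f_equal. apply re_scal_l.
Qed.

Lemma sol_Bloch : Bloch sol.
Proof.
  split; [apply sol_analytic|].
  apply Rbar_le_lt_trans with (Finite (growth_bound + 2)); [|easy].
  apply sup_disc_le. intros z Hz. unfold unit_disc in Hz.
  rewrite sol_C_derive by auto. rewrite !Cmod_mult, sol_Cmod, Cmod_R, Rabs_pos_eq by lra.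
  eapply Rle_trans; [|apply (glim_growth1 z Hz)]. unfold growth1.
  pose proof (Cmod_ge_0 z). pose proof (Cmod_ge_0 (glim 1 z)).
  assert (Hd : 0 <= 1 - Cmod z ^ 2) by nra.
  rewrite Rmult_comm. apply Rmult_le_compat_l; auto.
  set (x := Re (glim 0 z)).
  assert (Hexp : exp (e * x) <= 1 + exp x).
  { pose proof (exp_pos x). destruct (Rle_or_lt 0 x).
    - assert (exp (e * x) <= exp x) by (apply exp_le_exp; nra). lra.
    - assert (exp (e * x) <= exp 0) by (apply exp_le_exp; nra). rewrite exp_0 in *. lra. }
  pose proof (exp_pos (e * x)).
  assert (Cmod (glim 1 z) * exp (e * x) <= Cmod (glim 1 z) * (1 + exp x)) by (apply Rmult_le_compat_l; auto).
  assert (0 <= Cmod (glim 1 z) * exp (e * x)) by (apply Rmult_le_pos; lra).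
  rewrite Rmult_assoc. nra.
Qed.

(** On the circle of radius r_j the limit differs from the boundary values X of g_j
    by at most 3, and max(x, 0) = (x + |x|) / 2 with |X| >= Phi(X) - 1; the
    mean of X is negligible by [gs_mean]. *)
Lemma log_plus_mean_lower j : 0 <= r j ->
  e * (/ 2 * (test_int (p j) - 2 * PI - 2) - 6 * PI) / (2 * PI) <= log_plus_mean sol (r j).
Proof.
  intros Hr0.
  pose proof Hp as [_ [_ [Hr Hg]]]. destruct (Hr j) as [_ Hr1].
  pose proof PI_RGT_0 as Hpi.
  set (u := fun t => e * Re (glim 0 (RtoC (r j) * unit_pt t))).
  assert (Hu : forall t, continuous u t).
  { intros t. apply @continuous_mult; [apply continuous_const | apply glim_circle_continuous; lra]. }
  set (v := fun t => / 2 * (u t + Rabs (u t))).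
  assert (Hv : forall t, continuous v t).
  { intros t. apply @continuous_mult; [apply continuous_const|]. apply @continuous_plus; auto.
    apply (continuous_comp u Rabs); auto. apply continuous_Rabs. }
  set (X := re_circle (p j)).
  assert (HX : cont_diff X) by apply cont_diff_re_circle.
  pose proof (cont_diff_comp _ _ cont_diff_Phi HX) as HPhi.
  assert (CX : forall t, continuous X t) by (intros; now apply cont_diff_continuous).
  assert (CP : forall t, continuous (fun t => Phi (X t)) t) by (intros; now apply cont_diff_continuous).
  assert (Hmean : log_plus_mean sol (r j) = 1 / (2 * PI) * circle_int v).
  { unfold log_plus_mean. f_equal. apply circle_int_ext. intros t.
    replace (circle_point (r j) t) with (RtoC (r j) * unit_pt t)%C
      by (unfold circle_point, unit_pt; apply injective_projections; simpl; ring).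
    rewrite sol_Cmod. unfold log_plus. rewrite ln_exp. fold (u t). unfold v.
    unfold Rmax, Rabs. destruct (Rle_dec (u t) 0), (Rcase_abs (u t)); lra. }
  rewrite Hmean.
  assert (Hlow : circle_int (fun t => e * (/ 2 * (Phi (X t) + X t)) + - (e * (7 / 2))) <= circle_int v).
  { apply circle_int_le; auto.
    - intros t. apply @continuous_plus; [|apply continuous_const].
      apply @continuous_mult; [apply continuous_const|].
      apply @continuous_mult; [apply continuous_const|]. now apply @continuous_plus.
    - intros t. unfold v, u.
      set (x := Re (glim 0 (RtoC (r j) * unit_pt t))). set (y := X t).
      assert (Hxy : y <= x + 3).
      { unfold y, X, re_circle, x. apply Re_le_of_close.
        destruct (Hg j) as [_ [_ [Hc _]]]. specialize (Hc t).
        assert (Hz : Cmod (RtoC (r j) * unit_pt t) <= r j).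
        { rewrite Cmod_mult, Cmod_unit_pt, Cmod_R, Rabs_pos_eq; lra. }
        pose proof (glim_close j _ Hz) as HG.
        set (z := (RtoC (r j) * unit_pt t)%C) in *.
        replace (peval (p j) (unit_pt t) - glim 0 z)%C
          with (- (peval (p j) z - peval (p j) (unit_pt t)) + - (glim 0 z - peval (p j) z))%C by ring.
        eapply Rle_trans; [apply Cmod_triangle|]. rewrite !Cmod_opp. lra. }
      pose proof (Phi_le y) as HP.
      assert (Hmax : / 2 * (y + Rabs y) <= / 2 * (x + Rabs x) + 3).
      { unfold Rabs. destruct (Rcase_abs y), (Rcase_abs x); lra. }
      rewrite Rabs_mult, (Rabs_pos_eq e) by lra.
      replace (/ 2 * (e * x + e * Rabs x)) with (e * (/ 2 * (x + Rabs x))) by ring.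
      rewrite <- Ropp_mult_distr_r_reverse, <- Rmult_plus_distr_l.
      apply Rmult_le_compat_l; lra. }
  rewrite circle_int_plus, circle_int_const, circle_int_scal, circle_int_scal, circle_int_plus in Hlow; auto;
    try (intros; apply continuous_const).
  2:{ intros t. now apply @continuous_plus. }
  2:{ intros t. apply @continuous_mult; [apply continuous_const|]. now apply @continuous_plus. }
  2:{ intros t. apply @continuous_mult; [apply continuous_const|].
      apply @continuous_mult; [apply continuous_const|]. now apply @continuous_plus. }
  fold X in Hlow. change (circle_int (fun t => Phi (X t))) with (test_int (p j)) in Hlow.
  pose proof (gs_mean j) as Hm. fold X in Hm. apply Rabs_le_between in Hm.
  change (circle_int (fun t => X t)) with (circle_int X) in Hlow.
  unfold Rdiv. rewrite Rmult_1_l, Rmult_comm.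
  apply Rmult_le_compat_l; [left; apply Rinv_0_lt_compat; lra|].
  eapply Rle_trans; [|exact Hlow].
  replace (e * (/ 2 * (test_int (p j) + circle_int X)) + 2 * PI * - (e * (7 / 2)))
    with (e * (/ 2 * (test_int (p j) + circle_int X) - 7 * PI)) by field.
  apply Rmult_le_compat_l; lra.
Qed.

(** A finite limit would bound the means at all radii close to 1, in
    particular at the radii r_j with large j. *)
Lemma sol_not_Nevanlinna : ~ Nevanlinna sol.
Proof.
  intros [_ [l Hl]].
  pose proof PI_RGT_0 as Hpi.
  destruct (proj1 (filterlim_locally _ _) Hl (mkposreal 1 Rlt_0_1)) as [d Hd].
  destruct (gs_r_lim (Rmax 0 (1 - d))) as [J HJ].
  { apply Rmax_lub_lt; [lra | pose proof (cond_pos d); lra]. }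
  destruct (gs_test_int_unbounded (2 * ((l + 1) * (2 * PI) / e + 6 * PI) + 2 * PI + 2) J) as [j [Hj Harea]].
  specialize (HJ j Hj).
  assert (Hr0 : 0 < r j) by (eapply Rle_lt_trans; [apply Rmax_l | exact HJ]).
  assert (Hrd : 1 - d < r j) by (eapply Rle_lt_trans; [apply Rmax_r | exact HJ]).
  pose proof Hp as [_ [_ [Hr _]]]. destruct (Hr j) as [_ Hr1].
  assert (Hlt : log_plus_mean sol (r j) < l + 1).
  { specialize (Hd (r j)).
    assert (Hb : ball l 1 (log_plus_mean sol (r j))).
    { apply Hd; [|exact Hr1]. change (Rabs (r j - 1) < d). rewrite Rabs_left; lra. }
    change (Rabs (log_plus_mean sol (r j) - l) < 1) in Hb.
    apply Rabs_lt_between in Hb. lra. }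
  pose proof (log_plus_mean_lower j ltac:(lra)) as Hlow.
  assert (l + 1 <= e * (/ 2 * (test_int (p j) - 2 * PI - 2) - 6 * PI) / (2 * PI)); [|lra].
  apply Rmult_le_reg_r with (2 * PI); [lra|].
  replace (e * (/ 2 * (test_int (p j) - 2 * PI - 2) - 6 * PI) / (2 * PI) * (2 * PI))
    with (e * (/ 2 * (test_int (p j) - 2 * PI - 2) - 6 * PI)) by (field; lra).
  apply Rle_trans with (e * ((l + 1) * (2 * PI) / e)); [right; field; lra|].
  apply Rmult_le_compat_l; lra.
Qed.

End Solution.
End Limit.

Theorem theorem3 (c : R) (hc : 0 < c) :
  exists A : C -> C,
    analytic_in_disc A /\
    Rbar_lt (L0_norm A) (Finite c) /\
    exists f : C -> C,
      analytic_in_disc f /\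
      solves_ode A f /\
      zero_free f /\
      Bloch f /\
      ~ Nevanlinna f.
Proof.
  destruct good_sequence_exists as [p [r Hp]].
  set (K := (growth_bound + 2) + (growth_bound + 2) ^ 2).
  assert (HK : 0 < K).
  { unfold K, growth_bound. pose proof (exp_pos 10). pose proof (pow2_ge_0 (24 * exp 10 + 172 + 2)). lra. }
  set (e := Rmin 1 (c / (2 * K))).
  assert (He : 0 < e <= 1).
  { split; [apply Rmin_pos; [lra | apply Rdiv_lt_0_compat; lra] | apply Rmin_l]. }
  assert (HeK : e * K < c).
  { apply Rle_lt_trans with (c / (2 * K) * K).
    - apply Rmult_le_compat_r; [lra | apply Rmin_r].
    - replace (c / (2 * K) * K) with (c / 2) by (field; lra). lra. }
  exists (coef p e). split; [exact (coef_analytic p r Hp e)|]. split.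
  - eapply Rbar_le_lt_trans; [exact (coef_L0 p r Hp e He) | exact HeK].
  - exists (sol p e). repeat split.
    + exact (sol_analytic p r Hp e).
    + exact (sol_solves p r Hp e).
    + exact (sol_zero_free p e).
    + apply (sol_Bloch p r Hp e He).
    + apply (sol_Bloch p r Hp e He).
    + exact (sol_not_Nevanlinna p r Hp e He).
Qed.
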